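(* Assume that $R^\dag\in H^k_{per}(0,2\pi)\cap D(F)$ with $2\le k\le 4$, let $\Omega^\dag=\Omega_{R^\dag}$, and let the data $m^\delta\in L^2(D)$ satisfy $\|\chi_{\Omega^\dag}-m^\delta\|_{L^2(D)}\le\delta$. Then any approximate minimizer $R_\alpha^\delta$ of the Tikhonov functional $J_\alpha^\delta$ with $\alpha=\delta^{4/k}$ satisfies $$\|F(R_\alpha^\delta)-\chi_{\Omega^\dag}\|_{L^2(D)}\le C\,\delta\qquad\text{and}\qquad \|R_\alpha^\delta-R^\dag\|_{H^r(0,2\pi)}\le C\,\delta^{1-r/k}\quad\text{for } 0\le r\le 2,$$ with a constant $C$ that only depends on the norm $\|R^\dag\|_{H^k(0,2\pi)}$ of the true solution $R^\dag$. The same estimates hold true if $\alpha$ is chosen by a discrepancy principle, i.e., $$\alpha=\max\{\alpha_0\,2^{-n}: n\ge 0 \text{ such that } \|F(R_\alpha^\delta)-m^\delta\|_{L^2(D)}\le 4\delta\}.$$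
   Context: Fix constants $0<r_0<r_1<1$ and let $D=(-1,1)^2$. $H^s_{per}(0,2\pi)$ is the subspace of periodic functions in the Sobolev space $H^s(0,2\pi)$, $s\ge 0$. For a radius function $R:[0,2\pi]\to\mathbb{R}_+$ set $\Omega_R=\{(r\cos\varphi,r\sin\varphi):0\le r<R(\varphi),\ 0\le\varphi\le 2\pi\}$. The operator $F:D(F)\subset H^2_{per}(0,2\pi)\to L^2(D)$ is $F(R)=\chi_{\Omega_R}$ (the characteristic function of $\Omega_R$), with domain $D(F)=\{R\in H^2_{per}(0,2\pi): r_0\le R(\varphi)\le r_1\}$. For $\alpha>0$ the Tikhonov functional is $J_\alpha^\delta(R)=\|F(R)-m^\delta\|_{L^2(D)}^2+\alpha\|R\|_{H^2(0,2\pi)}^2$. An element $R_\alpha^\delta\in D(F)$ is called an approximate minimizer for the regularization parameter $\alpha>0$ if $J_\alpha^\delta(R_\alpha^\delta)\le\inf_{R\in D(F)}J_\alpha^\delta(R)+\delta^2$. In the discrepancy principle, $\alpha_0$ is the initial value of the regularization parameter, and the inequality for a given $n$ is tested with an approximate minimizer $R_\alpha^\delta$ for $\alpha=\alpha_0 2^{-n}$.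
   Formalization: For the discrepancy principle the noise level δ is assumed bounded by an arbitrary δ_max, and C may depend on α_0 and δ_max besides the norm of R†; without this the claim fails for large δ (α=α_0 is then accepted) or for α_0→0. *)

(* Defs.v *)
From HB Require Import structures.
From mathcomp Require Export all_boot all_order all_algebra.
From mathcomp Require Export all_classical all_reals all_analysis.

Set Implicit Arguments.
Unset Strict Implicit.
Unset Printing Implicit Defensive.

Import Order.TTheory GRing.Theory Num.Theory.
Import numFieldNormedType.Exports.

Local Open Scope classical_set_scope.
Local Open Scope ring_scope.

(* [L2_on mu A f]: f restricted to A is in L^2(A, mu).  A function on A is
   represented by a total function whose values outside A are irrelevant; the
   patch [f \_ A] (f on A, 0 elsewhere) gives the library's L^p predicate and
   norm for the restricted measure. *)
Definition L2_on (d : measure_display) (T : measurableType d) (R : realType)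
    (mu : {measure set T -> \bar R}) (A : set T) (f : T -> R) : Prop :=
  (f \_ A) \in Lfun mu 2%:E.

Definition L2norm_on (d : measure_display) (T : measurableType d)
    (R : realType) (mu : {measure set T -> \bar R}) (A : set T) (f : T -> R) :
    \bar R :=
  'N[mu]_2%:E [EFin \o (f \_ A)]%E.

Section PeriodicSobolev.
Context {R : realType}.
Implicit Types (f : R -> R) (s : R) (n : int).

(* |c_n|^2 for the Fourier coefficient
   c_n = (2 pi)^-1 \int_0^{2 pi} f(t) e^{-i n t} dt of a real function f. *)
Definition fourier_coef_sqr f n : R :=
  ((2 * pi)^-1 *
     \int[lebesgue_measure]_(t in `[0, 2 * pi]) (f t * cos (n%:~R * t))) ^+ 2
  + ((2 * pi)^-1 *
     \int[lebesgue_measure]_(t in `[0, 2 * pi]) (f t * sin (n%:~R * t))) ^+ 2.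

(* The Fourier norm of the periodic Sobolev space of real order s >= 0,
     ||f||_{H^s}^2 = 2 pi \sum_{n in Z} (1 + n^2)^s |c_n|^2.
   The factor 2 pi makes the norm of H^0 the usual norm of L^2(0, 2 pi). *)
Definition sobolev_norm s f : \bar R :=
  (((2 * pi)%:E * \esum_(n in [set: int])
      ((1 + n%:~R ^+ 2) `^ s * fourier_coef_sqr f n)%:E) `^ 2^-1)%E.

(* H^s_per(0, 2 pi); the behaviour of f outside [0, 2 pi] is irrelevant. *)
Definition Hper s : set (R -> R) :=
  [set f | L2_on lebesgue_measure `[0, 2 * pi] f
           /\ (sobolev_norm s f < +oo)%E].

End PeriodicSobolev.

Section StarShapedReconstruction.
Context {R : realType}.
Implicit Types (rad : R -> R) (m : R * R -> R) (alpha delta : R).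

Definition plane_measure :
    {measure set (measurableTypeR R * measurableTypeR R) -> \bar R} :=
  (@lebesgue_measure R \x @lebesgue_measure R)%E.

Definition square : set (R * R) := `]-1, 1[ `*` `]-1, 1[.

Definition Omega rad : set (R * R) :=
  [set p | exists r phi : R,
     [/\ 0 <= r, r < rad phi, 0 <= phi <= 2 * pi
       & p = (r * cos phi, r * sin phi)]].

Definition forward rad : R * R -> R := \1_(Omega rad).

Definition forward_dom (r0 r1 : R) : set (R -> R) :=
  [set rad | Hper 2 rad
             /\ forall phi, 0 <= phi <= 2 * pi -> r0 <= rad phi <= r1].

Definition L2D_norm (g : R * R -> R) : \bar R :=
  L2norm_on plane_measure square g.

Definition tikhonov alpha m rad : \bar R :=
  (L2D_norm (forward rad \- m)%R ^+ 2
   + alpha%:E * sobolev_norm 2 rad ^+ 2)%E.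

Definition approx_minimizer (r0 r1 alpha delta : R) m rad : Prop :=
  forward_dom r0 r1 rad /\
  (tikhonov alpha m rad
     <= ereal_inf [set tikhonov alpha m x | x in forward_dom r0 r1]
        + (delta ^+ 2)%:E)%E.

(* [sel alpha] is the approximate minimizer with which the parameter alpha is
   tested. *)
Definition discrepancy_set (alpha0 delta : R) m (sel : R -> R -> R) : set R :=
  [set alpha | exists n : nat, alpha = alpha0 * 2 ^- n
     /\ (L2D_norm (forward (sel alpha) \- m)%R <= (4 * delta)%:E)%E].

Definition is_max (A : set R) (a : R) : Prop := A a /\ ubound A a.

Definition error_estimates (C k delta : R) (rad_true rad : R -> R) : Prop :=
  (L2D_norm (forward rad \- forward rad_true)%R <= (C * delta)%:E)%E /\
  forall r : R, 0 <= r <= 2 ->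
    (sobolev_norm r (rad \- rad_true)%R <= (C * delta `^ (1 - r / k))%:E)%E.

End StarShapedReconstruction.

(* Main.v *)
From HB Require Import structures.
Require Import Defs.
From mathcomp Require Import ring lra measurable_realfun.

Import Order.TTheory GRing.Theory Num.Theory.
Import numFieldNormedType.Exports.

Local Open Scope classical_set_scope.
Local Open Scope ring_scope.

(** Let e be the difference between an approximate minimizer and the true
    radius. Three facts carry the proof.

    Stability. The squared distance of the two characteristic functions is the
    area of the symmetric difference of the domains. In polar coordinates this
    area is at least r0 times the L1 norm of e, because all radii exceed r0, and
    the L1 norm of e dominates its squared L2 norm, because all radii lie in
    ]0, 1[. Hence the L2 norm of e is bounded by a multiple of the data error
    ([polar_area], [le_area_symdiff], [forward_conditional_stability]). Radii are
    only known to be measurable, so polar coordinates are derived for Borel sets,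
    from Tonelli's theorem and one-dimensional substitutions, and the domains
    are shown to be Borel sets ([measurable_Omega]).

    Minimality. Comparing the Tikhonov functional at the minimizer and at the
    true radius bounds the squared residual plus alpha |e|_2^2 by 2 delta^2
    plus 2 alpha times the H^2 inner product of the true radius with - e. The
    smoothness of the true radius makes this inner product small: it is bounded
    by the H^k norm of the true radius times the H^(4 - k) norm of e, which lies
    between |e|_0 and |e|_2 since 2 <= k <= 4. On the Fourier side all of this
    can be done for each frequency separately ([weight_split],
    [sobolev_compare]), so that neither a Hoelder inequality for series nor the
    completeness of the trigonometric system enters; the passage from the L2
    norm of e to |e|_0 is Bessel's inequality ([bessel]).

    Absorption. With the L2 norm of e bounded by the data error, the right side
    can be absorbed into the left one, and the squared residual plus
    alpha |e|_2^2 is at most 5 delta^2 + C alpha^(k/2) ([residual_le]). For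
    alpha = delta^(4/k) both terms are of order delta^2, which gives the bounds
    for the data error, |e|_0 and |e|_2; the intermediate norms |e|_r follow by
    interpolation ([error_estimates_of_bounds]).

    For the discrepancy principle the residual is bounded by 4 delta by the test
    itself. If the parameter 2 alpha was rejected, its residual is larger than
    4 delta, and since 5 < 4^2 the term C (2 alpha)^(k/2) must dominate delta^2,
    so alpha is at least of order delta^(4/k) ([discrepancy_lower_bound]); if
    no parameter was rejected, alpha = alpha0 and delta <= delta_max gives the
    same. This lower bound suffices for the estimate of |e|_2
    ([discrepancy_rate]). *)

(** * Affine substitution for the Lebesgue measure *)

(* The measure structure of a push-forward takes a proof that the map is
   measurable, which has to be supplied by hand. *)
Local Notation image_measure :=
  measure_function_pushforward__canonical__measure_function_Measure.

Section Substitution.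
Context {R : realType}.
Implicit Types (a c : R) (A : set (measurableTypeR R)).
Local Notation mu := (@lebesgue_measure R).

Lemma measurable_affine a c :
  measurable_fun [set: measurableTypeR R]
    ((fun x => a + c * x) : measurableTypeR R -> measurableTypeR R).
Proof. by apply: measurable_funD => //; exact: mulrl_measurable. Qed.

Lemma lebesgue_measure_dilation a c A : 0 < c -> measurable A ->
  mu A = (c%:E * mu ((fun x => (a + c * x)%R) @^-1` A))%E.
Proof.
move=> c0 mA.
pose phi : measurableTypeR R -> measurableTypeR R := (fun x => a + c * x).
have mphi : measurable_fun [set: measurableTypeR R] phi by exact: measurable_affine.
have cnng : 0 <= c by exact: ltW.
pose nu : {measure set (measurableTypeR R) -> \bar R} :=
  mscale (NngNum cnng) (image_measure mu mphi).
rewrite (_ : (_ * _)%E = nu A)//.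
apply: lebesgue_measure_unique => // _ [[u v]] _ <-.
rewrite /nu/= /mscale/= /pushforward/=.
rewrite (_ : phi @^-1` _ = `]((u - a) / c), ((v - a) / c)]%classic); last first.
  apply/seteqP; split => x /=; rewrite !in_itv/= /phi;
    by rewrite ltr_pdivrMr// ler_pdivlMr// ltrBlDl lerBrDl mulrC.
rewrite !lebesgue_measure_itv/= !lte_fin ltr_pM2r ?invr_gt0// ltrD2r.
case: ifPn => // _; last by rewrite mule0.
by rewrite -!EFinB -EFinM; congr (_%:E); field; rewrite gt_eqF.
Qed.

Lemma lebesgue_measure_affine a c A : c != 0 -> measurable A ->
  mu A = (`|c|%:E * mu ((fun x => (a + c * x)%R) @^-1` A))%E.
Proof.
rewrite neq_lt => /orP[c0|c0] mA; last first.
  by rewrite gtr0_norm//; exact: lebesgue_measure_dilation.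
rewrite ltr0_norm// (@lebesgue_measure_dilation a (- c)) ?oppr_gt0//.
congr (_ * _)%E.
rewrite -[LHS]lebesgue_measureN.
  by congr (mu _); apply/seteqP; split => x /=; rewrite mulrNN.
by rewrite -[X in measurable X]setTI; exact: measurable_affine.
Qed.

Lemma ge0_integral_affine a c (f : R -> \bar R) : c != 0 ->
  measurable_fun [set: R] f -> (forall x, (0 <= f x)%E) ->
  (\int[mu]_x f x = `|c|%:E * \int[mu]_x f (a + c * x)%R)%E.
Proof.
move=> c0 mf f0.
pose phi : measurableTypeR R -> measurableTypeR R := (fun x => a + c * x).
have mphi : measurable_fun [set: measurableTypeR R] phi by exact: measurable_affine.
pose nu : {measure set (measurableTypeR R) -> \bar R} :=
  mscale (NngNum (normr_ge0 c)) (image_measure mu mphi).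
transitivity (\int[nu]_x f x)%E.
  apply: eq_measure_integral => /= A mA _.
  exact: lebesgue_measure_affine.
rewrite ge0_integral_mscale//; congr (_ * _)%E.
by rewrite (ge0_integral_pushforward mphi).
Qed.

End Substitution.

(** * The arctangent as a change of variable *)

Section Angle.
Context {R : realType}.
Local Notation mu := (@lebesgue_measure R).
Let I : set R := `](- (pi / 2)), (pi / 2)[%classic.

Definition cauchy_density (t : R) : R := (1 + t ^+ 2)^-1.

Let w := cauchy_density.

Lemma cauchy_density_gt0 t : 0 < w t.
Proof. by rewrite invr_gt0 ltr_wpDr ?sqr_ge0. Qed.

Lemma continuous_cauchy_density : continuous w.
Proof.
move=> t; apply: cvgV; first by rewrite gt_eqF// ltr_wpDr ?sqr_ge0.
by apply: cvgD; [exact: cvg_cst|]; exact: exprn_continuous.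
Qed.

Lemma measurable_cauchy_density : measurable_fun [set: R] w.
Proof. exact: continuous_measurable_fun continuous_cauchy_density. Qed.

Lemma measurable_atan : measurable_fun [set: R] (@atan R).
Proof. by apply: continuous_measurable_fun => t; exact: continuous_atan. Qed.

(** The arctangent generates a Stieltjes measure, which serves below as a common
   value for two measures that agree with it on half-open intervals. *)
HB.instance Definition _ := isCumulative.Build R _ R (@atan R) (@le_atan R)
  (fun x => cvg_at_right_filter (@continuous_atan R x)).

(** The Cauchy distribution without its normalizing factor: the image under the
    tangent of the length measure of an interval of length pi. *)
Definition cauchy_measure (A : set (measurableTypeR R)) : \bar R :=
  (\int[mu]_(t in A) (w t)%:E)%E.

Let cm0 : cauchy_measure set0 = 0%E. Proof. exact: integral_set0. Qed.

Let cm_ge0 A : (0 <= cauchy_measure A)%E.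
Proof. by apply: integral_ge0 => t _; rewrite lee_fin ltW// cauchy_density_gt0. Qed.

Let cm_additive : semi_sigma_additive cauchy_measure.
Proof.
apply: semi_sigma_additive_nng_induced => [|t].
  by apply/measurable_EFinP; exact: measurable_cauchy_density.
by rewrite lee_fin ltW// cauchy_density_gt0.
Qed.

HB.instance Definition _ := isMeasure.Build _ _ _ cauchy_measure
  cm0 cm_ge0 cm_additive.

Lemma cauchy_measure_itv (a b : R) : a <= b ->
  cauchy_measure `]a, b] = (atan b - atan a)%:E.
Proof.
rewrite le_eqVlt => /predU1P[->|ab].
  by rewrite set_itv_ge ?bnd_simp ?ltxx// cm0 subrr.
rewrite /cauchy_measure integral_itv_obnd_cbnd; last first.
  by apply/measurable_EFinP/measurable_funTS; exact: measurable_cauchy_density.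
rewrite (@continuous_FTC2 _ w atan) ?EFinB//.
- exact/continuous_subspaceT/continuous_cauchy_density.
- by split=> [x _| |]; [exact: derivable_atan|exact/cvg_at_right_filter/continuous_atan
    |exact/cvg_at_left_filter/continuous_atan].
- by move=> x _; rewrite derive1_atan.
Qed.

(** The substitution u = atan t for sets instead of functions. Working on the
    t-axis is what makes it short: there the two measures only have to be
    compared on bounded intervals, where the fundamental theorem of calculus
    applies, and no case distinction at the ends of the u-interval occurs. *)
Lemma cauchy_measure_preimage_atan (A : set (measurableTypeR R)) : measurable A ->
  cauchy_measure (atan @^-1` A) = mu (A `&` I).
Proof.
move=> mA.
(* cos u `^ (-1) is the inverse of cos u where cos u > 0, hence T is the
   tangent on I; written this way T is measurable on the whole line *)
pose T : measurableTypeR R -> measurableTypeR R := fun u => sin u * cos u `^ (-1).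
have mT : measurable_fun [set: measurableTypeR R] T.
  apply: measurable_funM; first exact: continuous_measurable_fun (@continuous_sin R).
  apply: (@measurableT_comp _ _ _ _ _ _ (fun x : measurableTypeR R => x `^ (-1) : measurableTypeR R)).
    exact: measurable_powR.
  exact: continuous_measurable_fun (@continuous_cos R).
have TE u : I u -> T u = tan u.
  by move=> uI; rewrite /T /tan -powR_inv1// ltW// cos_gt0_pihalf.
have mI : measurable (I : set (measurableTypeR R)) by exact: measurable_itv.
pose nu : {measure set (measurableTypeR R) -> \bar R} :=
  image_measure (mrestr mu mI) mT.
have lsE (a b : R) : a <= b -> lebesgue_stieltjes_measure atan `]a, b] = (atan b - atan a)%:E.
  move=> ab; rewrite /lebesgue_stieltjes_measure /measure_extension/=.
  rewrite measurable_mu_extE/=; last exact: is_ocitv.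
  by rewrite wlength_itv_bnd.
have oc (m : {measure set (measurableTypeR R) -> \bar R}) :
    (forall a b, a <= b -> m `]a, b]%classic = (atan b - atan a)%:E) ->
    forall B, measurable B -> lebesgue_stieltjes_measure atan B = m B.
  move=> mE; apply: lebesgue_stieltjes_measure_unique => _ [[a b]] _ <-.
  have [ab|ba] := leP a b; first by rewrite mE// lsE.
  by rewrite /= set_itv_ge ?measure0// bnd_simp -leNgt ltW.
have nuE B : measurable B -> cauchy_measure B = nu B.
  move=> mB; rewrite -(oc cauchy_measure) ?(oc nu)// => a b ab; last exact: cauchy_measure_itv.
  rewrite /nu/= /pushforward/= /mrestr/= (_ : _ `&` I = `]atan a, atan b]%classic).
    rewrite lebesgue_measure_itv/= lte_fin; case: ltP => //.
    by move=> /(conj (le_atan ab)) /andP/le_anti->; rewrite subrr.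
  apply/seteqP; split => u.
    move=> [/= Tu uI]; move: Tu; rewrite (TE _ uI) !in_itv/= => /andP[au ub].
    by rewrite -(tanK uI) lt_atan//= le_atan.
  rewrite /= in_itv/= => /andP[au ub].
  have uI : I u.
    rewrite /I/= in_itv/= (lt_le_trans (atan_gtNpi2 a) (ltW au)).
    by rewrite (le_lt_trans ub (atan_ltpi2 b)).
  split => //; rewrite TE//= in_itv/=; apply/andP; split.
    by rewrite ltNge; apply/negP => /le_atan; rewrite tanK// leNgt au.
  by rewrite leNgt; apply/negP => /lt_atan; rewrite tanK// ltNge ub.
rewrite nuE /nu/= /pushforward/= /mrestr/=.
  congr (mu _); apply/seteqP; split => u [/= Au Iu]; split=> //.
    by move: Au; rewrite TE// tanK.
  by rewrite TE// tanK.
by rewrite -[X in measurable X]setTI; exact: measurable_atan.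
Qed.
End Angle.

(** * Polar coordinates in the plane *)

Section Polar.
Context {R : realType}.
Local Notation T := (measurableTypeR R).
Local Notation mu := (@lebesgue_measure R).

Let measurable_sinR : measurable_fun [set: T] (@sin R : T -> T).
Proof. exact: continuous_measurable_fun (@continuous_sin R). Qed.

Let measurable_cosR : measurable_fun [set: T] (@cos R : T -> T).
Proof. exact: continuous_measurable_fun (@continuous_cos R). Qed.

Lemma sin_atan_cos (t : R) : sin (atan t) = t * cos (atan t).
Proof.
have c0 : cos (atan t) != 0.
  by rewrite gt_eqF// cos_gt0_pihalf// atan_gtNpi2 atan_ltpi2.
by rewrite -{2}(atanK t) /tan divfK.
Qed.

Lemma cos_atan_sqr (t : R) : cos (atan t) ^+ 2 = cauchy_density t.
Proof. by rewrite cos_atan exprVn sqr_sqrtr// addr_ge0// sqr_ge0. Qed.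

(** Polar coordinates with a signed radius: u is the angle measured from the
    y-axis, and negative r covers the lower half-plane, so that the plane minus
    the x-axis is parametrized at once.
    Each horizontal line y is sheared by x = y t, which produces the factor
    |y|; for fixed t the substitution y = r cos (atan t) produces the factor
    cos (atan t) ^ 2 = 1 / (1 + t ^ 2); for fixed r this density is absorbed by
    the substitution u = atan t. Tonelli's theorem exchanges the order of
    integration between these steps. *)
Lemma polar_area (S : set (T * T)) : measurable S ->
  plane_measure S =
  (\int[mu]_(u in `](- (pi / 2))%R, (pi / 2)%R[)
     \int[mu]_r (`|r| * \1_S (r * sin u, r * cos u))%:E)%E.
Proof.
move=> mS.
have mS1 : measurable_fun [set: T * T] (\1_S : T * T -> R) by exact: measurable_indic.
have mid : measurable_fun [set: T] (fun x : T => `|x| : R) by exact: normr_measurable.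
pose f0 (p : T * T) : \bar R := (\1_S p)%:E.
have mf0 : measurable_fun [set: T * T] f0 by exact/measurable_EFinP.
have f00 p : (0 <= f0 p)%E by rewrite lee_fin.
pose f1 (p : T * T) : \bar R := (`|p.2| * \1_S (p.2 * p.1, p.2))%:E.
have mf1 : measurable_fun [set: T * T] f1.
  apply/measurable_EFinP/measurable_funM; first exact: (measurableT_comp mid).
  apply: (measurableT_comp mS1); apply: measurable_fun_pair => //.
  by apply: (@measurable_funM _ _ R).
have f10 p : (0 <= f1 p)%E by rewrite lee_fin mulr_ge0.
pose f2 (p : T * T) : \bar R :=
  (cauchy_density p.1 * `|p.2| * \1_S (p.2 * sin (atan p.1), p.2 * cos (atan p.1)))%:E.
have mf2 : measurable_fun [set: T * T] f2.
  apply/measurable_EFinP/measurable_funM.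
    apply: measurable_funM; last exact: (measurableT_comp mid).
    by apply: measurableT_comp => //; exact: measurable_cauchy_density.
  apply: (measurableT_comp mS1); apply: measurable_fun_pair;
    apply: (@measurable_funM _ _ R) => //; (apply: measurableT_comp; first by []);
    (apply: measurableT_comp => //; exact: measurable_atan).
have f20 p : (0 <= f2 p)%E.
  by rewrite lee_fin !mulr_ge0// ltW// cauchy_density_gt0.
pose J : set T := `](- (pi / 2)), (pi / 2)[%classic.
have mJ : measurable_fun [set: T] (\1_J : T -> R).
  by apply: measurable_indic; exact: measurable_itv.
pose f3 (p : T * T) : \bar R :=
  (\1_J p.1 * (`|p.2| * \1_S (p.2 * sin p.1, p.2 * cos p.1)))%:E.
have mf3 : measurable_fun [set: T * T] f3.
  apply/measurable_EFinP/measurable_funM.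
    exact: (measurableT_comp mJ).
  apply: measurable_funM; first exact: (measurableT_comp mid).
  apply: (measurableT_comp mS1); apply: measurable_fun_pair;
    apply: (@measurable_funM _ _ R) => //; exact: measurableT_comp.
have f30 p : (0 <= f3 p)%E by rewrite lee_fin !mulr_ge0.
transitivity (\int[mu]_y \int[mu]_x f0 (x, y))%E.
  rewrite -(@fubini_tonelli _ _ _ _ R mu mu f0 mf0 f00).
  by rewrite -(setIT S) -integral_indic// (@fubini_tonelli1 _ _ _ _ R mu mu f0 mf0 f00).
transitivity (\int[mu]_y \int[mu]_t f1 (t, y))%E.
  apply: ge0_ae_eq_integral => //.
  - exact: (@measurable_fun_fubini_tonelli_G _ _ _ _ R mu f0 mf0 f00).
  - exact: (@measurable_fun_fubini_tonelli_G _ _ _ _ R mu f1 mf1 f10).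
  - by move=> y _; apply: integral_ge0.
  - by move=> y _; apply: integral_ge0.
  (* the shear degenerates on the line y = 0 only *)
  exists [set 0]; split; [exact: measurable_set1|exact: lebesgue_measure_set1|].
  move=> y /= yN; apply: contrapT => /eqP y0; apply: yN => _.
  rewrite (@ge0_integral_affine _ 0 y)//; last exact: (measurable_fun_pair1 y mf0).
  rewrite -ge0_integralZl//.
  - by apply: eq_integral => t _; rewrite add0r -EFinM.
  apply/measurable_EFinP; apply: (measurableT_comp mS1).
  by apply: measurable_fun_pair => //; exact: measurable_affine.
rewrite -(@fubini_tonelli _ _ _ _ R mu mu f1 mf1 f10).
transitivity (\int[mu]_t \int[mu]_r f2 (t, r))%E.
  apply: eq_integral => t _.
  have c0 : 0 < cos (atan t) by rewrite cos_gt0_pihalf// atan_gtNpi2 atan_ltpi2.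
  have mf1t := measurable_fun_pair2 t mf1.
  rewrite (@ge0_integral_affine _ 0 (cos (atan t)) _ _ mf1t) ?gt_eqF//.
  rewrite -ge0_integralZl//.
    apply: eq_integral => r _; rewrite add0r /f1 /f2/= -EFinM gtr0_norm// normrM gtr0_norm//.
    rewrite -cos_atan_sqr sin_atan_cos; congr (_%:E).
    by rewrite (mulrC _ r) (mulrC t) !mulrA expr2.
  by apply: (measurableT_comp mf1t); exact: measurable_affine.
rewrite (@fubini_tonelli _ _ _ _ R mu mu f2 mf2 f20).
transitivity (\int[mu]_r \int[mu]_u f3 (u, r))%E; last first.
  rewrite -(@fubini_tonelli _ _ _ _ R mu mu f3 mf3 f30) [in RHS]integral_mkcond.
  apply: eq_integral => u _.
  rewrite patchE /f3/= indicE; case: ifPn => uI.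
    by apply: eq_integral => r _; rewrite /= mul1r.
  by apply: integral0_eq => r _; rewrite mul0r.
apply: eq_integral => r _.
pose A : set T := [set u | S (r * sin u, r * cos u)].
have mA : measurable A.
  have mg : measurable_fun [set: T] (fun u : T => (r * sin u, r * cos u) : T * T).
    by apply: measurable_fun_pair; apply: (@measurable_funM _ _ R).
  by have := mg measurableT _ mS; rewrite setTI.
have mA' : measurable (atan @^-1` A : set T).
  by rewrite -[X in measurable X]setTI; exact: measurable_atan.
have mw : measurable_fun [set: T] (fun t => (cauchy_density t)%:E).
  by apply/measurable_EFinP; exact: measurable_cauchy_density.
transitivity (`|r|%:E * cauchy_measure (atan @^-1` A))%E.
  rewrite /cauchy_measure [X in (_ * X)%E]integral_mkcond -ge0_integralZl//.
  - apply: eq_integral => t _; rewrite patchE /f2/= indicE (_ : (_ \in S) = (t \in atan @^-1` A)).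
      by case: ifPn => _; rewrite ?mulr1 ?mulr0 ?mule0// -EFinM mulrC.
    by apply/idP/idP; rewrite !inE.
  - by apply: (iffLR (measurable_restrictT _ mA')); exact: measurable_funTS mw.
  - by move=> t _; rewrite patchE; case: ifPn => // _; rewrite lee_fin ltW// cauchy_density_gt0.
have mJm : measurable J by exact: measurable_itv.
rewrite cauchy_measure_preimage_atan// -/J -(integral_indic mu mJm mA).
rewrite [X in (_ * X)%E]integral_mkcond -ge0_integralZl//.
- apply: eq_integral => u _; rewrite patchE /f3/= !indicE.
  rewrite (_ : ((r * sin u, r * cos u) \in S) = (u \in A)).
    by case: ifPn => _; rewrite ?mul0r ?mul1r ?mule0// -EFinM.
  by apply/idP/idP; rewrite !inE.
- apply: (iffLR (measurable_restrictT _ mJm)); apply: measurable_funTS.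
  by apply/measurable_EFinP; exact: measurable_indic.
- by move=> u _; rewrite patchE; case: ifPn => // _; rewrite lee_fin.
Qed.

End Polar.

(** * Star-shaped domains *)

Section StarShaped.
Context {R : realType}.
Implicit Types (rad : R -> R).
Local Notation T := (measurableTypeR R).
Local Notation mu := (@lebesgue_measure R).

Lemma cos_3pihalf : cos (pi + pi / 2) = 0 :> R.
Proof. by rewrite addrC cosDpi cos_pihalf oppr0. Qed.

Lemma sin_3pihalf : sin (pi + pi / 2) = - 1 :> R.
Proof. by rewrite addrC sinDpi sin_pihalf. Qed.

Lemma cos_eq1 (x : R) : - (2 * pi) < x < 2 * pi -> cos x = 1 -> x = 0.
Proof.
move=> /andP[x1 x2] cx.
have s0 : sin (x / 2) = 0.
  apply/eqP; rewrite -sqrf_eq0; apply/eqP.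
  have := cosD (x / 2) (x / 2); rewrite -splitr cx -!expr2 cos2sin2 => h; lra.
have [x0|x0|//] := ltgtP x 0.
- have : 0 < sin (- (x / 2)) by apply: sin_gt0_pi; apply/andP; split; lra.
  by rewrite sinN s0 oppr0 ltxx.
- have : 0 < sin (x / 2) by apply: sin_gt0_pi; apply/andP; split; lra.
  by rewrite s0 ltxx.
Qed.

(** Both ends of the closed interval represent the same direction, whence the
    strict inequalities for y. *)
Lemma circle_inj (x y : R) : 0 <= x <= 2 * pi -> 0 < y < 2 * pi ->
  cos x = cos y -> sin x = sin y -> x = y.
Proof.
move=> /andP[x0 x1] /andP[y0 y1] cxy sxy.
apply/eqP; rewrite -subr_eq0; apply/eqP/cos_eq1; first by apply/andP; split; lra.
by rewrite cosB cxy sxy -!expr2 cos2Dsin2.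
Qed.

Lemma Omega_polar rad (r y : R) : 0 < r -> 0 < y < 2 * pi ->
  Omega rad (r * cos y, r * sin y) <-> r < rad y.
Proof.
move=> r0 /andP[y0 y1]; split; last first.
  by move=> ry; exists r, y; split => //; [exact: ltW|rewrite !ltW].
move=> [r' [x [r'0 r'x x02 [e1 e2]]]].
have rr : r = r'.
  apply/eqP; rewrite -(@eqrXn2 _ 2) ?(ltW r0)//; apply/eqP.
  have -> : r ^+ 2 = (r * cos y) ^+ 2 + (r * sin y) ^+ 2.
    by rewrite !exprMn -mulrDr cos2Dsin2 mulr1.
  by rewrite e1 e2 !exprMn -mulrDr cos2Dsin2 mulr1.
subst r'; have rn : r != 0 by rewrite gt_eqF.
suff -> : y = x by [].
by apply/esym/circle_inj => //; [rewrite y0|exact: (mulfI rn)|exact: (mulfI rn)].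
Qed.

Lemma measurable_lt_set d (X : measurableType d) (f g : X -> R) :
  measurable_fun [set: X] f -> measurable_fun [set: X] g ->
  measurable [set x | f x < g x].
Proof.
move=> mf mg; have := @measurable_fun_ltr _ _ _ _ _ _ mf mg measurableT [set true].
by rewrite setTI; apply.
Qed.

(** For c = pi / 2 this is the upper, for c = 3 pi / 2 the lower half of the
    domain. On such a half-plane the polar angle of (x, y) is c - atan (x / y),
    a measurable function, so that membership becomes the comparison of two
    measurable functions. *)
Lemma measurable_Omega_half rad (c : R) :
  measurable_fun `[0, 2 * pi] rad ->
  (forall x, 0 <= x <= 2 * pi -> 0 < rad x) ->
  pi / 2 <= c <= pi + pi / 2 -> cos c = 0 ->
  measurable (Omega rad `&` [set p | 0 < sin c * p.2] : set (T * T)).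
Proof.
move=> mrad rad0 /andP[c1 c2] cc.
have s2 : sin c ^+ 2 = 1 by rewrite -[RHS](cos2Dsin2 c) cc expr0n add0r.
have pp := pi_gt0 R.
(* x / y, written with sin c * y > 0 since sin c is 1 or -1 *)
pose ang (p : T * T) : T := c - atan (p.1 * (sin c * p.2) `^ (-1) * sin c).
pose rho : T -> R := rad \_ `[0, 2 * pi].
have mrho : measurable_fun [set: T] rho.
  by apply: (iffLR (measurable_restrictT _ _)) => //; exact: measurable_itv.
have msp : measurable_fun [set: T * T] (fun p : T * T => sin c * p.2 : T).
  by apply: (@measurable_funM _ _ R).
have mang : measurable_fun [set: T * T] ang.
  apply: (@measurable_funB _ _ R) => //.
  apply: (@measurableT_comp _ _ _ _ _ _ (@atan R : T -> T)); first exact: measurable_atan.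
  apply: (@measurable_funM _ _ R) => //; apply: (@measurable_funM _ _ R) => //.
  by apply: (@measurableT_comp _ _ _ _ _ _ (fun x : T => x `^ (-1) : T)) => //; exact: measurable_powR.
rewrite (_ : _ `&` _ = [set p : T * T | 0 < sin c * p.2] `&`
   [set p | p.1 ^+ 2 + p.2 ^+ 2 < rho (ang p) ^+ 2]).
  apply: measurableI; apply: measurable_lt_set => //.
    by apply: measurable_funD; apply: measurable_funX.
  by apply: measurable_funX; exact: measurableT_comp.
suff key (x y : R) : 0 < sin c * y ->
    Omega rad (x, y) <-> x ^+ 2 + y ^+ 2 < rho (ang (x, y)) ^+ 2.
  by apply/seteqP; split => -[x y] [/= h1 h2]; split => //; exact/key.
move=> y0; have sc0 : sin c != 0 by rewrite -sqrf_eq0 s2 oner_eq0.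
have yn0 : y != 0 by apply: contraTneq y0 => ->; rewrite mulr0 ltxx.
set a := atan (x / y).
have -> : ang (x, y) = c - a.
  rewrite /ang/= powR_inv1 ?(ltW y0)//; congr (c - atan _); field.
  by rewrite yn0.
have ca0 : 0 < cos a by rewrite cos_gt0_pihalf// atan_gtNpi2 atan_ltpi2.
have ca := atan_gtNpi2 (x / y); have ca' := atan_ltpi2 (x / y).
have c0 : 0 < c - a < 2 * pi by rewrite /a; apply/andP; split; lra.
have c0' : 0 <= c - a <= 2 * pi by case/andP: c0 => ? ?; rewrite !ltW.
pose r := sin c * y / cos a.
have r0 : 0 < r by rewrite divr_gt0.
have xE : x = r * cos (c - a).
  rewrite cosB cc mul0r add0r /a sin_atan_cos -/a /r.
  have -> : sin c * y / cos a * (sin c * (x / y * cos a)) = sin c ^+ 2 * x.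
    by field; rewrite yn0 gt_eqF.
  by rewrite s2 mul1r.
have yE : y = r * sin (c - a).
  rewrite sinB cc mul0r subr0 /r.
  have -> : sin c * y / cos a * (sin c * cos a) = sin c ^+ 2 * y.
    by field; rewrite gt_eqF.
  by rewrite s2 mul1r.
have -> : x ^+ 2 + y ^+ 2 = r ^+ 2.
  by rewrite xE yE !exprMn -mulrDr cos2Dsin2 mulr1.
have -> : rho (c - a) = rad (c - a) by rewrite /rho patchE mem_set//= in_itv.
rewrite xE yE Omega_polar//.
by rewrite ltr_pXn2r// nnegrE ltW// rad0.
Qed.

(** The two open half-planes are covered by the previous lemma. On the x-axis
    the values of rad at 0, pi and 2 pi all matter, but the trace of the domain
    is star-shaped about 0, hence an interval. *)
Lemma measurable_Omega rad :
  measurable_fun `[0, 2 * pi] rad ->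
  (forall x, 0 <= x <= 2 * pi -> 0 < rad x) ->
  measurable (Omega rad : set (T * T)).
Proof.
move=> mrad rad0; have pp := pi_gt0 R.
pose A : set T := [set x | Omega rad (x, 0)].
have -> : Omega rad = (Omega rad `&` [set p | 0 < sin (pi / 2) * p.2])
   `|` (Omega rad `&` [set p | 0 < sin (pi + pi / 2) * p.2]) `|` (A `*` [set 0]).
  rewrite sin_3pihalf sin_pihalf; apply/seteqP; split=> [[x y] Oxy|[x y]].
    have [y0|y0|y0] := ltgtP y 0.
    - by left; right; split => //=; rewrite mulN1r oppr_gt0.
    - by left; left; split => //=; rewrite mul1r.
    - by right; split => //=; rewrite /A/= -y0.
  by move=> [[[]//|[]//]|[/= Ax ->]].
apply: measurableU; first apply: measurableU.
- apply: measurable_Omega_half; rewrite ?cos_pihalf//; apply/andP; split; lra.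
- apply: measurable_Omega_half; rewrite ?cos_3pihalf//; apply/andP; split; lra.
apply: measurableX; last exact: measurable_set1.
apply: is_interval_measurable => x y Ax Ay z /andP[xz zy].
have star (v t : R) : 0 <= t <= 1 -> A v -> A (t * v).
  move=> /andP[t0 t1] [r [phi [r0 rphi h [-> e2]]]].
  exists (t * r), phi; split => //; first exact: mulr_ge0.
    by apply: le_lt_trans rphi; rewrite ler_piMl.
  by rewrite -!mulrA -e2 mulr0.
have [z0|z0] := leP 0 z.
  have [y0|y0] := eqVneq y 0.
    by have -> : z = y by rewrite y0 in zy *; lra.
  have y1 : 0 < y by rewrite lt_neqAle eq_sym y0 (le_trans z0 zy).
  by rewrite -(divfK y0 z); apply: star => //; rewrite divr_ge0 ?(ltW y1)// ler_pdivrMr// mul1r.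
have x0 : x < 0 by exact: le_lt_trans z0.
rewrite -(divfK (negbT (lt_eqF x0)) z); apply: star => //.
by rewrite ler_ndivrMr// mul1r xz andbT -mulrNN -invrN divr_ge0// oppr_ge0 ltW.
Qed.
End StarShaped.

(** * Area of the symmetric difference of two star-shaped domains *)

Section Monotone.
Local Open Scope ereal_scope.
Import HBNNSimple.

(** The integral of a nonnegative function is a supremum over the simple
    functions below it, so monotonicity holds without any measurability. *)
Lemma le_ge0_integral d (X : measurableType d) (R : realType)
    (m : {measure set X -> \bar R}) (D : set X) (f g : X -> \bar R) :
  (forall x, D x -> 0 <= f x) -> (forall x, D x -> f x <= g x) ->
  \int[m]_(x in D) f x <= \int[m]_(x in D) g x.
Proof.
move=> f0 fg; rewrite integral_mkcond [leRHS]integral_mkcond.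
have fg' x : (f \_ D) x <= (g \_ D) x.
  by rewrite !patchE; case: ifPn => // /set_mem/fg.
have f0' x : 0 <= (f \_ D) x by rewrite patchE; case: ifPn => // /set_mem/f0.
rewrite !ge0_integralTE// => [|x]; last exact: le_trans (fg' x).
by apply: ereal_sup_le => _ [h hf <-]; exists h => // x; exact: le_trans (hf x) (fg' x).
Qed.

End Monotone.

Section SymmetricDifference.
Context {R : realType}.
Implicit Types (rad : R -> R).
Local Notation T := (measurableTypeR R).
Local Notation mu := (@lebesgue_measure R).

Let Delta rad1 rad2 : set (T * T) := Omega rad1 `+` Omega rad2.

(** On the ray of angle x the symmetric difference is the radial interval
    between rad1 x and rad2 x, where the Jacobian |r| is at least r0. The line
    of parameter u consists of the two opposite rays of angles pi / 2 - u and
    3 pi / 2 - u. *)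
Lemma radial_integral_ge (rad1 rad2 : R -> R) (r0 u : R) : 0 < r0 ->
  (forall x, 0 <= x <= 2 * pi -> r0 <= rad1 x) ->
  (forall x, 0 <= x <= 2 * pi -> r0 <= rad2 x) ->
  - (pi / 2) < u < pi / 2 ->
  ((r0 * `|rad1 (pi / 2 - u) - rad2 (pi / 2 - u)|
    + r0 * `|rad1 (pi + pi / 2 - u) - rad2 (pi + pi / 2 - u)|)%:E
   <= \int[mu]_r (`|r| * \1_(Delta rad1 rad2) (r * sin u, r * cos u))%:E)%E.
Proof.
move=> r00 h1 h2 /andP[u1 u2]; have pp := pi_gt0 R.
set p := pi / 2 - u; set q := pi + pi / 2 - u.
have p0 : 0 < p < 2 * pi by rewrite /p; apply/andP; split; lra.
have q0 : 0 < q < 2 * pi by rewrite /q; apply/andP; split; lra.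
have p0' : 0 <= p <= 2 * pi by case/andP: p0 => ? ?; rewrite !ltW.
have q0' : 0 <= q <= 2 * pi by case/andP: q0 => ? ?; rewrite !ltW.
pose mn x := Num.min (rad1 x) (rad2 x); pose mx x := Num.max (rad1 x) (rad2 x).
have mn0 x : 0 <= x <= 2 * pi -> r0 <= mn x by move=> x0; rewrite le_min h1// h2.
have len x : mx x - mn x = `|rad1 x - rad2 x|.
  rewrite /mx /mn; case: (leP (rad1 x) (rad2 x)) => h.
    by rewrite distrC ger0_norm// subr_ge0.
  by rewrite ger0_norm// subr_ge0 ltW.
have mnmx x : mn x <= mx x by rewrite -subr_ge0 len.
have DP s x : 0 < s -> 0 < x < 2 * pi -> mn x <= s < mx x ->
    Delta rad1 rad2 (s * cos x, s * sin x).
  move=> s0 x0; rewrite /mn /mx ge_min lt_max => /andP[le lt].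
  have O1 := Omega_polar rad1 s x s0 x0; have O2 := Omega_polar rad2 s x s0 x0.
  case/orP: lt => lt; [left|right]; split; try exact/O1; try exact/O2.
    by move=> /O2 lt2; move: le; rewrite !leNgt lt lt2.
  by move=> /O1 lt1; move: le; rewrite !leNgt lt lt1.
pose I1 : set T := `[mn p, mx p[%classic.
pose I2 : set T := `](- mx q), (- mn q)]%classic.
have mI1 : measurable I1 by exact: measurable_itv.
have mI2 : measurable I2 by exact: measurable_itv.
have I12 : I1 `&` I2 = set0.
  apply/seteqP; split => // x []; rewrite /I1 /I2 /= !in_itv/= => /andP[a _] /andP[_ b].
  by have := mn0 _ p0'; have := mn0 _ q0'; lra.
have mu1 : mu I1 = `|rad1 p - rad2 p|%:E.
  rewrite lebesgue_measure_itv/= lte_fin -len; case: ltP => //.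
  by rewrite le_eqVlt ltNge mnmx orbF => /eqP ->; rewrite subrr.
have mu2 : mu I2 = `|rad1 q - rad2 q|%:E.
  rewrite lebesgue_measure_itv/= lte_fin -len ltrN2.
  case: ltP => [_|]; first by rewrite -EFinD opprK addrC.
  by rewrite le_eqVlt ltNge mnmx orbF => /eqP ->; rewrite subrr.
rewrite (_ : (_ + _)%:E = \int[mu]_r (r0 * \1_(I1 `|` I2) r)%:E)%E; last first.
  rewrite EFinD !EFinM -mu1 -mu2 -ge0_muleDr// -measureU//.
  under eq_integral do rewrite EFinM.
  rewrite ge0_integralZl//; last 2 first.
  - by apply/measurable_EFinP; apply: measurable_indic; exact: measurableU.
  - by rewrite lee_fin ltW.
  by rewrite integral_indic ?setIT//; exact: measurableU.
apply: le_ge0_integral => r _; first by rewrite lee_fin mulr_ge0// ltW.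
rewrite lee_fin indicE; have [|_] := boolP (r \in _); last by rewrite mulr0 mulr_ge0.
rewrite inE mulr1 => -[]; rewrite /I1 /I2 /= in_itv/= => /andP[ra rb].
  have rr0 := le_trans (mn0 _ p0') ra.
  have r_gt0 : 0 < r by exact: lt_le_trans rr0.
  rewrite gtr0_norm// indicE mem_set ?mulr1//.
  have := DP r p r_gt0 p0; rewrite /p cosB sinB cos_pihalf sin_pihalf.
  by rewrite !mul0r !mul1r add0r subr0; apply; rewrite ra.
have rr0 : r0 <= - r by have := mn0 _ q0'; lra.
have r_lt0 : 0 < - r by exact: lt_le_trans rr0.
rewrite ltr0_norm -?oppr_gt0// indicE mem_set ?mulr1//.
have := DP (- r) q r_lt0 q0; rewrite /q cosB sinB cos_3pihalf sin_3pihalf.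
by rewrite !mul0r !mulN1r add0r subr0 !mulrNN; apply; apply/andP; split; lra.
Qed.

Lemma ge0_integral_reflect (c : R) (f : R -> R) :
  measurable_fun [set: R] f -> (forall x, 0 <= f x) ->
  (\int[mu]_(u in `](- (pi / 2))%R, (pi / 2)%R[) (f (c - u))%:E =
   \int[mu]_(x in `](c - pi / 2)%R, (c + pi / 2)%R[) (f x)%:E)%E.
Proof.
move=> mf f0; rewrite [RHS]integral_mkcond (@ge0_integral_affine _ c (- 1)).
- rewrite normrN1 mul1e integral_mkcond; apply: eq_integral => u _.
  rewrite !patchE mulN1r; congr (if _ then _ else _).
  by apply/idP/idP; rewrite !inE/= !in_itv/= => /andP[? ?]; apply/andP; split; lra.
- by rewrite oppr_eq0 oner_eq0.
- apply: (iffLR (measurable_restrictT _ _)); first exact: measurable_itv.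
  by apply: measurable_funTS; exact/measurable_EFinP.
- by move=> x; rewrite patchE; case: ifPn => // _; rewrite lee_fin.
Qed.

Lemma le_area_symdiff (rad1 rad2 : R -> R) (r0 : R) : 0 < r0 ->
  measurable_fun `[0, 2 * pi] rad1 -> measurable_fun `[0, 2 * pi] rad2 ->
  (forall x, 0 <= x <= 2 * pi -> r0 <= rad1 x) ->
  (forall x, 0 <= x <= 2 * pi -> r0 <= rad2 x) ->
  (r0%:E * \int[mu]_(x in `[0%R, (2 * pi)%R]) `|rad1 x - rad2 x|%:E
    <= plane_measure (Omega rad1 `+` Omega rad2))%E.
Proof.
move=> r00 m1 m2 h1 h2; have pp := pi_gt0 R.
have mD : measurable (Delta rad1 rad2).
  have mO rad : measurable_fun `[0, 2 * pi] rad ->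
      (forall x, 0 <= x <= 2 * pi -> r0 <= rad x) -> measurable (Omega rad : set (T * T)).
    by move=> m h; apply: measurable_Omega => // x /h; exact: lt_le_trans.
  by apply: measurableU; apply: measurableD; exact: mO.
pose e : T -> R := (fun x => `|rad1 x - rad2 x|) \_ `[0, 2 * pi].
have me : measurable_fun [set: T] e.
  apply: (iffLR (measurable_restrictT _ _)); first exact: measurable_itv.
  by apply: measurableT_comp => //; exact: measurable_funB.
have e0 x : 0 <= e x by rewrite /e patchE; case: ifPn.
have mec c : measurable_fun [set: T] (fun u : T => e (c - u)).
  by apply: measurableT_comp => //; apply: (@measurable_funB _ _ R).
have mEc c D : measurable_fun (D : set T) (fun u : T => (e (c - u))%:E).
  by apply/measurable_EFinP; apply: measurable_funTS.
have mE D : measurable_fun (D : set T) (fun u : T => (e u)%:E).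
  by apply/measurable_EFinP; apply: measurable_funTS.
rewrite polar_area//.
apply: (@le_trans _ _ (\int[mu]_(u in `](- (pi / 2))%R, (pi / 2)%R[)
    (r0%:E * ((e (pi / 2 - u))%:E + (e (pi + pi / 2 - u))%:E)))%E); last first.
  apply: le_ge0_integral => u /=.
    by move=> _; rewrite mule_ge0// ?adde_ge0 ?lee_fin// ltW.
  rewrite in_itv/= => uI; apply: le_trans (radial_integral_ge _ _ _ _ r00 h1 h2 uI).
  move/andP: uI => [u1 u2]; rewrite /e !patchE.
  by do 2 (rewrite mem_set/= ?in_itv/=; last by apply/andP; split; lra);
    rewrite -EFinD -EFinM mulrDr.
rewrite ge0_integralZl//; last 3 first.
- by apply: emeasurable_funD; exact: mEc.
- by move=> u _; rewrite adde_ge0// lee_fin.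
- by rewrite lee_fin ltW.
apply: lee_wpmul2l; first by rewrite lee_fin ltW.
rewrite ge0_integralD//; [|by move=> *; rewrite lee_fin|by move=> *; rewrite lee_fin].
rewrite !ge0_integral_reflect// subrr.
have -> : pi / 2 + pi / 2 = pi :> R by lra.
have -> : pi + pi / 2 - pi / 2 = pi :> R by lra.
have -> : pi + pi / 2 + pi / 2 = 2 * pi :> R by lra.
rewrite integral_itv_bndo_bndc; last exact: mE.
rewrite integral_itv_obnd_cbnd; last exact: mE.
rewrite [X in (_ + X)%E]integral_itv_bndo_bndc; last exact: mE.
rewrite -ge0_integral_setU//; last 2 first.
- by move=> *; rewrite lee_fin.
- apply/disj_setPRL => x /=; rewrite !in_itv/= => /andP[]; lra.
rewrite (_ : _ `|` _ = `[0, 2 * pi]%classic).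
  by apply: le_ge0_integral => // x xI; rewrite /e patchE mem_set.
apply/seteqP; split => x /=; rewrite !in_itv/=.
  by case=> /andP[? ?]; apply/andP; split; lra.
move=> /andP[? ?]; case: (leP x pi) => ?; [left|right]; apply/andP; split; lra.
Qed.

End SymmetricDifference.

(** * Conditional stability of the forward operator *)

Section DataSpace.
Context {R : realType}.
Implicit Types (rad : R -> R) (f g m : R * R -> R).
Local Notation T := (measurableTypeR R).
Local Notation mu := (@lebesgue_measure R).

Lemma poweR_sqr (x : \bar R) : (0 <= x -> x `^ 2 = x ^+ 2)%E.
Proof.
case: x => [r| |]//.
  by rewrite lee_fin => r0; rewrite poweR_EFin powR_mulrn// -EFin_expe.
by move=> _; rewrite poweRyr ?pnatr_eq0// expe2 mulyy.
Qed.

Lemma L2D_normE f :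
  (L2D_norm f ^+ 2 = \int[plane_measure]_(p in square) ((f p) ^+ 2)%:E)%E.
Proof.
rewrite -poweR_sqr ?Lnorm_ge0// /L2D_norm /L2norm_on poweR_Lnorm ?pnatr_eq0//.
rewrite [RHS]integral_mkcond; apply: eq_integral => p _.
rewrite poweR_sqr// [abse _]/= -EFin_expe real_normK ?num_real// !patchE.
by case: ifPn => // _; rewrite expr0n.
Qed.

Lemma L2D_norm_le f (c : R) : 0 <= c ->
  (L2D_norm f <= c%:E)%E <-> (L2D_norm f ^+ 2 <= (c ^+ 2)%:E)%E.
Proof. by move=> c0; rewrite EFin_expe lee_sqr// ?Lnorm_ge0 ?lee_fin. Qed.

Lemma measurable_square : measurable (square : set (T * T)).
Proof. by apply: measurableX; exact: measurable_itv. Qed.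

Lemma L2D_norm_triangle_sqr f g m :
  measurable_fun (square : set (T * T)) f ->
  measurable_fun (square : set (T * T)) g ->
  measurable_fun (square : set (T * T)) m ->
  (L2D_norm (f \- g)%R ^+ 2 <=
    2%:E * L2D_norm (f \- m)%R ^+ 2 + 2%:E * L2D_norm (g \- m)%R ^+ 2)%E.
Proof.
move=> mf mg mm; rewrite !L2D_normE.
have ms := measurable_square.
have msq (h : R * R -> R) : measurable_fun (square : set (T * T)) h ->
    measurable_fun (square : set (T * T)) (fun p => ((h p - m p) ^+ 2)%:E).
  by move=> mh; apply/measurable_EFinP/measurable_funX/measurable_funB.
have sq0 (h : R * R -> R) : forall p : T * T, square p -> (0 <= ((h p - m p) ^+ 2)%:E)%E.
  by move=> p _; rewrite lee_fin sqr_ge0.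
rewrite -!ge0_integralZl//; try exact: msq; try exact: sq0.
rewrite -ge0_integralD//; last 4 first.
- by move=> p ?; rewrite mule_ge0// sq0.
- by apply: measurable_funeM; exact: msq.
- by move=> p ?; rewrite mule_ge0// sq0.
- by apply: measurable_funeM; exact: msq.
apply: le_ge0_integral => p _; first by rewrite lee_fin sqr_ge0.
rewrite -!EFinM -EFinD lee_fin /=.
have := sqr_ge0 (f p + g p - 2 * m p); nra.
Qed.

(** The domains lie inside the square, so no area is lost by restricting to it. *)
Lemma Omega_square rad : (forall x, 0 <= x <= 2 * pi -> rad x < 1) ->
  Omega rad `<=` square.
Proof.
move=> h _ [r [phi [r0 rphi hphi ->]]].
have r1 : r < 1 by rewrite (lt_trans rphi)// h.
have bnd (c : R) : `|c| <= 1 -> (r * c) \in `]-1, 1[.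
  move=> c1; rewrite in_itv/= -ltr_norml normrM ger0_norm//.
  by rewrite (le_lt_trans _ r1)// ler_piMr.
split; apply: bnd.
  by rewrite ler_norml cos_geN1 cos_le1.
by rewrite ler_norml sin_geN1 sin_le1.
Qed.

Lemma area_symdiffE rad1 rad2 :
  measurable (Omega rad1 : set (T * T)) -> measurable (Omega rad2 : set (T * T)) ->
  Omega rad1 `<=` square -> Omega rad2 `<=` square ->
  (L2D_norm (forward rad1 \- forward rad2)%R ^+ 2 =
   plane_measure (Omega rad1 `+` Omega rad2))%E.
Proof.
move=> m1 m2 s1 s2; rewrite L2D_normE.
have mD : measurable (Omega rad1 `+` Omega rad2 : set (T * T)).
  by apply: measurableU; exact: measurableD.
rewrite (_ : Omega rad1 `+` Omega rad2 = (Omega rad1 `+` Omega rad2) `&` square).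
  rewrite -integral_indic//; last exact: measurable_square.
  apply: eq_integral => p _; rewrite /forward /= !indicE.
  have [i1|n1] := pselect (Omega rad1 p); have [i2|n2] := pselect (Omega rad2 p).
  - rewrite (mem_set i1) (mem_set i2) subrr expr0n memNset//.
    by case=> -[].
  - by rewrite (mem_set i1) (memNset n2) subr0 expr1n mem_set//; left.
  - by rewrite (memNset n1) (mem_set i2) sub0r sqrrN expr1n mem_set//; right.
  - rewrite (memNset n1) (memNset n2) subrr expr0n memNset//.
    by case=> -[].
by apply/esym/setIidl; move=> p [[/s1]|[/s2]].
Qed.

Lemma measurable_forward rad : measurable (Omega rad : set (T * T)) ->
  measurable_fun (square : set (T * T)) (forward rad).
Proof. by move=> m; apply: measurable_funTS; exact: measurable_indic. Qed.

Lemma L2_on_measurable d (X : measurableType d) (m : {measure set X -> \bar R})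
    (A : set X) (f : X -> R) : measurable A ->
  L2_on m A f -> measurable_fun A f.
Proof.
move=> mA /sub_Lfun_mfun /[!inE] /= mf.
exact: (iffRL (measurable_restrictT _ mA)).
Qed.

Section Admissible.
Variables (r0 r1 : R) (r0_gt0 : 0 < r0) (r1_lt1 : r1 < 1).

Lemma forward_dom_measurable rad : forward_dom r0 r1 rad ->
  measurable_fun (`[0, 2 * pi] : set T) rad.
Proof. by move=> [[/L2_on_measurable + _] _]; apply; exact: measurable_itv. Qed.

Lemma forward_dom_Omega rad : forward_dom r0 r1 rad ->
  measurable (Omega rad : set (T * T)) /\ Omega rad `<=` square.
Proof.
move=> dr; have [_ bd] := dr; split.
  apply: measurable_Omega; first exact: forward_dom_measurable.
  by move=> x /bd /andP[+ _]; exact: lt_le_trans.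
by apply: Omega_square => x /bd /andP[_ h]; exact: le_lt_trans r1_lt1.
Qed.

(** Radii in the domain differ by less than 1, so the square of their difference
    is bounded by its absolute value. This turns an L1 estimate that is
    quadratic in the data misfit into an L2 estimate that is linear in it. *)
Lemma forward_conditional_stability rad1 rad2 :
  forward_dom r0 r1 rad1 -> forward_dom r0 r1 rad2 ->
  (r0%:E * \int[mu]_(x in `[0%R, (2 * pi)%R]) ((rad1 x - rad2 x) ^+ 2)%:E
    <= L2D_norm (forward rad1 \- forward rad2)%R ^+ 2)%E.
Proof.
move=> d1 d2; have [w1 s1] := forward_dom_Omega _ d1.
have [w2 s2] := forward_dom_Omega _ d2; have [_ b1] := d1; have [_ b2] := d2.
have aux (a b : R) : r0 <= a <= r1 -> r0 <= b <= r1 -> -1 <= a - b <= 1.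
  move: r0_gt0 r1_lt1 => ? ? /andP[? ?] /andP[? ?].
  by apply/andP; split; lra.
rewrite area_symdiffE//; apply: le_trans (le_area_symdiff _ _ _ r0_gt0 _ _ _ _).
- apply: lee_wpmul2l; first by rewrite lee_fin ltW.
  apply: le_ge0_integral => x /=; first by rewrite lee_fin sqr_ge0.
  rewrite in_itv/= => x0.
  rewrite lee_fin -real_normK ?num_real// expr2 ler_piMl//.
  by rewrite ler_norml; apply: aux; [exact: b1|exact: b2].
- exact: forward_dom_measurable.
- exact: forward_dom_measurable.
- by move=> x /b1 /andP[].
- by move=> x /b2 /andP[].
Qed.

Lemma forward_triangle rad1 rad2 m :
  forward_dom r0 r1 rad1 -> forward_dom r0 r1 rad2 ->
  L2_on plane_measure square m ->
  (L2D_norm (forward rad1 \- forward rad2)%R ^+ 2 <=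
   2%:E * L2D_norm (forward rad1 \- m)%R ^+ 2
   + 2%:E * L2D_norm (forward rad2 \- m)%R ^+ 2)%E.
Proof.
move=> /forward_dom_Omega[w1 _] /forward_dom_Omega[w2 _] mm.
apply: L2D_norm_triangle_sqr; try exact: measurable_forward.
by apply: L2_on_measurable mm; exact: measurable_square.
Qed.

End Admissible.
End DataSpace.

(** * Bessel's inequality for the Fourier coefficients *)

Section Bessel.
Context {R : realType}.
Local Notation T := (measurableTypeR R).
Local Notation mu := (@lebesgue_measure R).
Let I : set T := `[0, 2 * pi]%classic.
Implicit Types (f g : R -> R) (n m : int).

Let mI : measurable I. Proof. exact: measurable_itv. Qed.

Let pi2_gt0 : 0 < 2 * pi :> R. Proof. by rewrite mulr_gt0// pi_gt0. Qed.

Let muI : mu I = (2 * pi)%:E.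
Proof. by rewrite lebesgue_measure_itv/= lte_fin pi2_gt0 oppr0 adde0. Qed.

(** A class of functions that is stable under the operations used below and on
    which all integrals over a period are finite. *)
Definition bounded_measurable f :=
  measurable_fun I f /\ exists M, forall x, I x -> `|f x| <= M.

Lemma bounded_measurable_integrable f : bounded_measurable f ->
  mu.-integrable I (EFin \o f).
Proof.
move=> [mf [M fM]]; apply: measurable_bounded_integrable => //.
  by rewrite [X in (X < _)%E]muI ltry.
exists M; split; first exact: num_real.
by move=> N MN x Ix; exact: le_trans (fM x Ix) (ltW MN).
Qed.

Lemma bounded_measurableM f g : bounded_measurable f -> bounded_measurable g ->
  bounded_measurable (fun x => f x * g x).
Proof.
move=> [mf [M fM]] [mg [N gN]]; split; first exact: measurable_funM.
by exists (M * N) => x Ix; rewrite normrM ler_pM// ?fM ?gN.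
Qed.

Lemma bounded_measurableB f g : bounded_measurable f -> bounded_measurable g ->
  bounded_measurable (fun x => f x - g x).
Proof.
move=> [mf [M fM]] [mg [N gN]]; split; first exact: measurable_funB.
by exists (M + N) => x Ix; rewrite (le_trans (ler_normB _ _))// lerD// ?fM ?gN.
Qed.

Lemma bounded_measurable_cst (c : R) : bounded_measurable (fun=> c).
Proof. by split; [exact: measurable_cst|exists `|c|]. Qed.

Lemma bounded_measurable_cos (a : R) : bounded_measurable (fun x => cos (a * x)).
Proof.
split; last by exists 1 => x _; exact: cos_max.
apply: measurable_funTS; apply: (@measurableT_comp _ _ _ _ _ _ (@cos R : T -> T)).
  exact: continuous_measurable_fun (@continuous_cos R).
exact: mulrl_measurable.
Qed.

Lemma bounded_measurable_sin (a : R) : bounded_measurable (fun x => sin (a * x)).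
Proof.
split; last by exists 1 => x _; exact: sin_max.
apply: measurable_funTS; apply: (@measurableT_comp _ _ _ _ _ _ (@sin R : T -> T)).
  exact: continuous_measurable_fun (@continuous_sin R).
exact: mulrl_measurable.
Qed.

Lemma bounded_measurableD f g : bounded_measurable f -> bounded_measurable g ->
  bounded_measurable (fun x => f x + g x).
Proof.
move=> [mf [M fM]] [mg [N gN]]; split; first exact: measurable_funD.
by exists (M + N) => x Ix; rewrite (le_trans (ler_normD _ _))// lerD// ?fM ?gN.
Qed.

Lemma bounded_measurableZ (c : R) f : bounded_measurable f ->
  bounded_measurable (fun x => c * f x).
Proof. by apply: bounded_measurableM; exact: bounded_measurable_cst. Qed.

Local Notation "\I f" := (\int[mu]_(t in I) f t) (at level 10, f at level 9).

Lemma RintD f g : bounded_measurable f -> bounded_measurable g ->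
  \I (fun t => f t + g t) = \I f + \I g.
Proof. by move=> bf bg; rewrite RintegralD//; exact: bounded_measurable_integrable. Qed.

Lemma RintB f g : bounded_measurable f -> bounded_measurable g ->
  \I (fun t => f t - g t) = \I f - \I g.
Proof. by move=> bf bg; rewrite RintegralB//; exact: bounded_measurable_integrable. Qed.

Lemma RintZ (c : R) f : bounded_measurable f -> \I (fun t => c * f t) = c * \I f.
Proof. by move=> bf; rewrite RintegralZl//; exact: bounded_measurable_integrable. Qed.

Lemma Rintegral_period F f : (forall x : R, is_derive x 1 F (f x)) ->
  continuous f -> \I f = F (2 * pi) - F 0.
Proof.
move=> dF cf; rewrite /Rintegral (@continuous_FTC2 _ f F)//.
- exact: continuous_subspaceT.
- have cF x : {for x, continuous F}.
    by apply/differentiable_continuous/derivable1_diffP; case: (dF x).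
  split=> [x _| |]; [by case: (dF x)|exact/cvg_at_right_filter/cF|exact/cvg_at_left_filter/cF].
- by move=> x _; rewrite derive1E; case: (dF x).
Qed.

Lemma trig_period n : sin (n%:~R * (2 * pi)) = 0 :> R /\ cos (n%:~R * (2 * pi)) = 1 :> R.
Proof.
have nat (k : nat) : sin (k%:R * (2 * pi)) = 0 :> R /\ cos (k%:R * (2 * pi)) = 1 :> R.
  have -> : k%:R * (2 * pi) = 0 + (pi *+ 2) *+ k :> R.
    by rewrite add0r -(mulr_natl pi 2) mulr_natl.
  by rewrite !periodicn ?sin0 ?cos0//; [exact: cosD2pi|exact: sinD2pi].
case: n => k; first exact: nat.
by rewrite NegzE mulrNz mulNr sinN cosN; have [-> ->] := nat k.+1; rewrite oppr0.
Qed.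

Let derive_scale (n : R) (x : R) : is_derive x 1 (fun t => n * t) n.
Proof. by apply: is_derive_eq; rewrite scaler1. Qed.

Lemma Rintegral_cos n : \I (fun t => cos (n%:~R * t)) = 2 * pi *+ (n == 0).
Proof.
have [->|n0] := eqVneq n 0.
  rewrite (_ : (fun _ => _) = cst 1); last by apply/funext => t; rewrite mul0r cos0.
  by rewrite Rintegral_cst// mul1r [X in fine X]muI.
have nR0 : n%:~R != 0 :> R by rewrite intr_eq0.
pose F t : R := n%:~R^-1 * sin (n%:~R * t).
have dF (x : R) : is_derive x 1 F (cos (n%:~R * x)).
  have h := is_derive1_comp (is_derive_sin (n%:~R * x)) (derive_scale n%:~R x).
  by apply: is_derive_eq; rewrite /GRing.scale/= mulrCA mulVf// mulr1.
rewrite (Rintegral_period F _ dF) => [|x].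
  by rewrite /F (trig_period n).1 !mulr0 sin0 mulr0 subrr.
apply: continuous_comp; last exact: continuous_cos.
by apply: continuousM; [exact: cvg_cst|exact: cvg_id].
Qed.

Lemma Rintegral_sin n : \I (fun t => sin (n%:~R * t)) = 0.
Proof.
have [->|n0] := eqVneq n 0.
  rewrite (_ : (fun _ => _) = cst 0); last by apply/funext => t; rewrite mul0r sin0.
  by rewrite Rintegral_cst// mul0r.
have nR0 : n%:~R != 0 :> R by rewrite intr_eq0.
pose F t : R := - n%:~R^-1 * cos (n%:~R * t).
have dF (x : R) : is_derive x 1 F (sin (n%:~R * x)).
  have h := is_derive1_comp (is_derive_cos (n%:~R * x)) (derive_scale n%:~R x).
  apply: is_derive_eq.
  by rewrite /GRing.scale/= !mulNr mulrN opprK mulrCA mulVf// mulr1.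
rewrite (Rintegral_period F _ dF) => [|x].
  by rewrite /F (trig_period n).2 mulr0 cos0 subrr.
apply: continuous_comp; last exact: continuous_sin.
by apply: continuousM; [exact: cvg_cst|exact: cvg_id].
Qed.

(** The Hartley kernel: a real orthogonal system indexed by all integers, all of
    whose members have the same norm. *)
Definition cas n (t : R) : R := cos (n%:~R * t) + sin (n%:~R * t).

Lemma bounded_measurable_cas n : bounded_measurable (cas n).
Proof.
by apply: bounded_measurableD; [exact: bounded_measurable_cos|exact: bounded_measurable_sin].
Qed.

Lemma cas_orthogonal n m : \I (fun t => cas n t * cas m t) = 2 * pi *+ (n == m).
Proof.
transitivity (\I (fun t => cos ((n - m)%:~R * t) + sin ((n + m)%:~R * t))).
  apply: eq_Rintegral => t _; rewrite /cas rmorphB rmorphD/=.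
  by rewrite (mulrBl t) (mulrDl _ _ t) cosB sinD; ring.
rewrite RintD; [|exact: bounded_measurable_cos|exact: bounded_measurable_sin].
by rewrite Rintegral_cos Rintegral_sin addr0 subr_eq0.
Qed.

(** Removing the component along cas n leaves the other coefficients unchanged
    and decreases the square norm by the square of the removed coefficient;
    iterating this along s never requires a double sum. *)
Lemma bessel_cas (s : seq int) f : uniq s -> bounded_measurable f ->
  \sum_(n <- s) (\I (fun t => f t * cas n t)) ^+ 2 <=
  2 * pi * \I (fun t => f t ^+ 2).
Proof.
elim: s f => [|n s IH] f /=.
  move=> _ bf; rewrite big_nil mulr_ge0//; first exact: ltW.
  by apply: Rintegral_ge0 => x _; exact: sqr_ge0.
move=> /andP[ns us] bf; rewrite big_cons.
have bc := bounded_measurable_cas n.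
set H := \I (fun t => f t * cas n t); pose c := H / (2 * pi).
pose f' t := f t - c * cas n t.
have bf' : bounded_measurable f'.
  by apply: bounded_measurableB => //; exact: bounded_measurableZ.
have coefE m : \I (fun t => f' t * cas m t) =
    \I (fun t => f t * cas m t) - c * (2 * pi *+ (n == m)).
  rewrite -cas_orthogonal -RintZ; last first.
    by apply: bounded_measurableM => //; exact: bounded_measurable_cas.
  rewrite -RintB; [|by apply: bounded_measurableM => //; exact: bounded_measurable_cas|].
    by apply: eq_Rintegral => t _; rewrite /f' mulrBl mulrA.
  apply: bounded_measurableZ.
  by apply: bounded_measurableM => //; exact: bounded_measurable_cas.
have normE : \I (fun t => f' t ^+ 2) = \I (fun t => f t ^+ 2) - H ^+ 2 / (2 * pi).
  have -> : \I (fun t => f' t ^+ 2) = \I (fun t => f' t * f t - c * (f' t * cas n t)).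
    by apply: eq_Rintegral => t _; rewrite /f'; ring.
  rewrite RintB ?RintZ; try by [apply: bounded_measurableM|apply: bounded_measurableZ; apply: bounded_measurableM].
  rewrite coefE eqxx mulr1n -/H /c divfK ?gt_eqF// subrr mulr0 subr0.
  have -> : \I (fun t => f' t * f t) = \I (fun t => f t ^+ 2 - c * (f t * cas n t)).
    by apply: eq_Rintegral => t _; rewrite /f'; ring.
  rewrite RintB ?RintZ; try by [apply: bounded_measurableM|apply: bounded_measurableZ; apply: bounded_measurableM].
  by rewrite -/H /c expr2 mulrAC.
have := IH f' us bf'; rewrite normE mulrBr [X in _ - X]mulrC divfK ?gt_eqF// lerBrDl.
apply: le_trans; rewrite lerD2l le_eqVlt; apply/orP; left; apply/eqP.
apply: eq_big_seq => m ms; rewrite coefE (_ : n == m = false) ?mulr0 ?subr0//.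
by apply: contraNF ns => /eqP ->.
Qed.

(** The cosine and sine coefficients of index n are half the sum and half the
    difference of the coefficients along cas n and cas (- n). *)
Lemma bessel (s : seq int) f : uniq s -> bounded_measurable f ->
  2 * pi * \sum_(n <- s) fourier_coef_sqr f n <= \I (fun t => f t ^+ 2).
Proof.
move=> us bf.
pose A n := \I (fun t => f t * cos (n%:~R * t)).
pose B n := \I (fun t => f t * sin (n%:~R * t)).
have bc n : bounded_measurable (fun t => f t * cos (n%:~R * t)).
  by apply: bounded_measurableM => //; exact: bounded_measurable_cos.
have bs n : bounded_measurable (fun t => f t * sin (n%:~R * t)).
  by apply: bounded_measurableM => //; exact: bounded_measurable_sin.
have casD n : \I (fun t => f t * cas n t) = A n + B n.
  by rewrite -RintD//; apply: eq_Rintegral => t _; rewrite -mulrDr.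
have casB n : \I (fun t => f t * cas (- n) t) = A n - B n.
  rewrite -RintB//; apply: eq_Rintegral => t _.
  by rewrite /cas mulrNz mulNr cosN sinN -mulrBr.
have h1 := bessel_cas s f us bf.
have us' : uniq [seq - n | n <- s] by rewrite map_inj_uniq//; exact: oppr_inj.
have h2 := bessel_cas _ f us' bf; rewrite big_map in h2.
have p0 : 0 < 2 * pi :> R by [].
have -> : 2 * pi * \sum_(n <- s) fourier_coef_sqr f n =
    (2 * pi)^-1 * (2^-1 * (\sum_(n <- s) (\I (fun t => f t * cas n t)) ^+ 2 +
       \sum_(n <- s) (\I (fun t => f t * cas (- n) t)) ^+ 2)).
  rewrite -big_split/= !mulr_sumr; apply: eq_bigr => n _.
  rewrite casD casB /fourier_coef_sqr -/(A n) -/(B n).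
  move: (2 * pi) p0 => p p0; field; exact: lt0r_neq0.
rewrite ler_pdivrMl//; move: h1 h2; set X := \sum_(_ <- _) _; set Y := \sum_(_ <- _) _.
set Z := 2 * pi * _; lra.
Qed.

End Bessel.

(** * Sobolev norms as weighted sums *)

Section WeightedSum.
Context {R : realType}.
Implicit Types (a b : int -> R).

(** The square of every Sobolev norm has this form, and all inequalities
    between such norms below are obtained term by term. *)
Definition wsum a : \bar R := ((2 * pi)%:E * \esum_(n in [set: int]) (a n)%:E)%E.

Let pi2_ge0 : 0 <= 2 * pi :> R. Proof. by rewrite mulr_ge0// pi_ge0. Qed.

Lemma wsum_ge0 a : (forall n, 0 <= a n) -> (0 <= wsum a)%E.
Proof. by move=> a0; rewrite mule_ge0// esum_ge0// => n _; rewrite lee_fin. Qed.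

Lemma le_wsum a b : (forall n, a n <= b n) -> (wsum a <= wsum b)%E.
Proof.
by move=> ab; rewrite lee_wpmul2l// le_esum// => n _; rewrite lee_fin.
Qed.

Lemma wsumD a b : (forall n, 0 <= a n) -> (forall n, 0 <= b n) ->
  wsum (fun n => a n + b n) = (wsum a + wsum b)%E.
Proof.
move=> a0 b0; rewrite /wsum -ge0_muleDr ?esum_ge0//; last 2 first.
- by move=> n _; rewrite lee_fin.
- by move=> n _; rewrite lee_fin.
by rewrite -esumD// => n _; rewrite lee_fin.
Qed.

Lemma wsum_le_fin a (K : R) :
  (forall s : seq int, uniq s -> 2 * pi * \sum_(n <- s) a n <= K) ->
  (wsum a <= K%:E)%E.
Proof.
move=> h; have p0 : 0 < 2 * pi :> R by rewrite mulr_gt0// pi_gt0.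
rewrite /wsum -lee_pdivlMl//.
apply: ge_ereal_sup => _ [A [fA _] <-].
rewrite fsbig_finite// sumEFin -EFinM lee_fin ler_pdivlMl//.
by apply: h; exact: finmap.fset_uniq.
Qed.

Let wsumZ_le (c : R) a : 0 <= c -> (forall n, 0 <= a n) ->
  (wsum (fun n => (c * a n)%R) <= c%:E * wsum a)%E.
Proof.
move=> c0 a0; rewrite /wsum muleCA lee_wpmul2l//.
apply: ge_ereal_sup => _ [A [fA _] <-].
under eq_fsbigr do rewrite EFinM.
rewrite -ge0_mule_fsumr => [|n]; last by rewrite lee_fin.
rewrite lee_wpmul2l// ?lee_fin//.
by apply: ereal_sup_ubound; exists A => //; split.
Qed.

Lemma wsumZ (c : R) a : 0 <= c -> (forall n, 0 <= a n) ->
  wsum (fun n => c * a n) = (c%:E * wsum a)%E.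
Proof.
move=> c0 a0; have [->|cn0] := eqVneq c 0.
  rewrite mul0e /wsum esum1 ?mule0// => n _.
  by rewrite mul0r.
have cp : 0 < c by rewrite lt_neqAle eq_sym cn0.
apply/eqP; rewrite eq_le wsumZ_le//=.
rewrite -lee_pdivlMl//.
have := @wsumZ_le c^-1 (fun n => c * a n); rewrite invr_ge0 c0 => /(_ isT).
have -> : (fun n => c^-1 * (c * a n)) = a by apply/funext => n; rewrite mulKf.
by apply => n; rewrite mulr_ge0.
Qed.

End WeightedSum.

Section Sobolev.
Context {R : realType}.
Implicit Types (f g : R -> R) (n : int) (s : R).

Definition freq n : R := 1 + n%:~R ^+ 2.

Lemma freq_ge1 n : 1 <= freq n.
Proof. by rewrite /freq lerDl sqr_ge0. Qed.

Lemma freq_gt0 n : 0 < freq n.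
Proof. exact: lt_le_trans (freq_ge1 n). Qed.

Lemma fourier_coef_sqr_ge0 f n : 0 <= fourier_coef_sqr f n.
Proof. by rewrite addr_ge0// sqr_ge0. Qed.

Lemma sobolev_term_ge0 s f n : 0 <= freq n `^ s * fourier_coef_sqr f n.
Proof. by rewrite mulr_ge0// ?powR_ge0// fourier_coef_sqr_ge0. Qed.

Lemma sobolev_norm_ge0 s f : (0 <= sobolev_norm s f)%E.
Proof. exact: poweR_ge0. Qed.

Lemma sobolev_norm_sqr s f :
  (sobolev_norm s f ^+ 2 = wsum (fun n => freq n `^ s * fourier_coef_sqr f n)%R)%E.
Proof.
rewrite /sobolev_norm poweR12_sqrt ?sqr_sqrte//.
  by apply: wsum_ge0 => n; exact: sobolev_term_ge0.
by apply: wsum_ge0 => n; exact: sobolev_term_ge0.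
Qed.

Lemma sobolev_norm_sqr0 f : (sobolev_norm 0 f ^+ 2 = wsum (fourier_coef_sqr f))%E.
Proof.
rewrite sobolev_norm_sqr; congr wsum; apply/funext => n.
by rewrite powRr0 mul1r.
Qed.

Lemma sobolev_norm_sqr2 f :
  (sobolev_norm 2 f ^+ 2 = wsum (fun n => freq n ^+ 2 * fourier_coef_sqr f n)%R)%E.
Proof.
rewrite sobolev_norm_sqr; congr wsum; apply/funext => n.
by rewrite powR_mulrn// ltW// freq_gt0.
Qed.

(** Bessel's inequality, over all finite sets of frequencies at once. *)
Lemma sobolev_norm0_le f : bounded_measurable f ->
  (sobolev_norm 0 f ^+ 2 <=
   \int[lebesgue_measure]_(x in `[0%R, (2 * pi)%R]) ((f x) ^+ 2)%:E)%E.
Proof.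
move=> bf.
have -> : (\int[lebesgue_measure]_(x in `[0%R, (2 * pi)%R]) ((f x) ^+ 2)%:E)%E =
    (\int[lebesgue_measure]_(x in `[0%R, (2 * pi)%R]) ((f x) ^+ 2))%:E.
  rewrite /Rintegral fineK// integrable_fin_num//.
  by apply: bounded_measurable_integrable; exact: bounded_measurableM.
rewrite sobolev_norm_sqr0; apply: wsum_le_fin => s us.
exact: bessel.
Qed.

(** This makes the Cauchy-Schwarz inequality at a single frequency work. With
    u = w * beta ^ (1 / 2) the right side is
    w ^ 4 * (u ^ (k - 2) + u ^ (k - 4)); the first summand is at least 1 for
    high frequencies, u >= 1, and the second one for low frequencies, u < 1. *)
Lemma weight_split (k beta w : R) : 2 <= k <= 4 -> 0 < beta -> 0 < w ->
  w ^+ 4 <= (beta^-1 + w ^+ 2) * (beta `^ (k / 2 - 1) * w `^ k).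
Proof.
move=> /andP[k2 k4] b0 w0.
pose u := w * beta `^ (1 / 2).
have u0 : 0 < u by rewrite mulr_gt0// powR_gt0.
have uE t : u `^ t = w `^ t * beta `^ (t / 2).
  by rewrite powRM ?ltW// ?powR_gt0// -powRrM; congr (_ * _ `^ _); ring.
have wD (s t : R) : w `^ (s + t) = w `^ s * w `^ t.
  by rewrite powRD// (gt_eqF w0) implybT.
have bD (s t : R) : beta `^ (s + t) = beta `^ s * beta `^ t.
  by rewrite powRD// (gt_eqF b0) implybT.
have w2 : w ^+ 2 = w `^ 2 by rewrite powR_mulrn// ltW.
have w4 : w ^+ 4 = w `^ 4 by rewrite powR_mulrn// ltW.
have Q0 : 0 < beta `^ (k / 2 - 1) * w `^ k by rewrite mulr_gt0// powR_gt0.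
have [u1|u1] := leP 1 u.
  apply: (@le_trans _ _ (w ^+ 2 * (beta `^ (k / 2 - 1) * w `^ k))); last first.
    by rewrite ler_pM2r// lerDr invr_ge0 ltW.
  have -> : beta `^ (k / 2 - 1) * w `^ k = w ^+ 2 * u `^ (k - 2).
    rewrite uE w2 mulrA -wD mulrC; congr (_ `^ _ * _ `^ _); lra.
  rewrite mulrA -exprD ler_pMr ?exprn_gt0//.
  by rewrite -[leLHS](powRr0 u); apply: ler_powR => //; lra.
apply: (@le_trans _ _ (beta^-1 * (beta `^ (k / 2 - 1) * w `^ k))); last first.
  by rewrite ler_pM2r// lerDl sqr_ge0.
have -> : beta^-1 * (beta `^ (k / 2 - 1) * w `^ k) = w ^+ 4 * u `^ (k - 4).
  rewrite uE w4 -powR_inv1 ?(ltW b0)// [LHS]mulrA -bD [RHS]mulrA -wD mulrC.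
  by congr (_ `^ _ * _ `^ _); lra.
rewrite ler_pMr ?exprn_gt0//.
have -> : k - 4 = - (4 - k) by ring.
have : u `^ (4 - k) <= 1 `^ (4 - k).
  by apply: ge0_ler_powR; rewrite ?nnegrE ?(ltW u0) ?(ltW u1)//; lra.
by rewrite powR1 powRN invf_ge1 ?powR_gt0.
Qed.

End Sobolev.

(** * Comparison and interpolation of Sobolev norms *)

Section SobolevComparison.
Context {R : realType}.
Implicit Types (f g : R -> R) (n : int).

Local Notation H0 f := (wsum (fourier_coef_sqr f)).
Local Notation H2 f := (wsum (fun n => freq n ^+ 2 * fourier_coef_sqr f n)%R).
Local Notation Hs s f := (wsum (fun n => freq n `^ s * fourier_coef_sqr f n)%R).

(** The cross term 2 w2 a (b - a) that appears when b ^ 2 is expanded about a is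
    absorbed by the arithmetic-geometric mean inequality. *)
Lemma inner_product_split (a b w2 P Q eta : R) : 0 < eta -> 0 < P ->
  w2 ^+ 2 <= P * Q ->
  w2 * (b - a) ^+ 2 + w2 * a ^+ 2 <=
  w2 * b ^+ 2 + (eta * P * (b - a) ^+ 2 + eta^-1 * Q * a ^+ 2).
Proof.
move=> e0 P0 PQ.
have eP0 : 0 < eta * P by rewrite mulr_gt0.
rewrite -(ler_pM2l eP0) -subr_ge0.
have -> : eta * P * (w2 * b ^+ 2 + (eta * P * (b - a) ^+ 2 + eta^-1 * Q * a ^+ 2))
    - eta * P * (w2 * (b - a) ^+ 2 + w2 * a ^+ 2) =
    (eta * P * (b - a) + w2 * a) ^+ 2 + (P * Q - w2 ^+ 2) * a ^+ 2.
  by field; rewrite gt_eqF.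
by rewrite addr_ge0 ?sqr_ge0// mulr_ge0 ?sqr_ge0// subr_ge0.
Qed.

Definition fourier_cos f n : R := (2 * pi)^-1 *
  \int[lebesgue_measure]_(t in `[0, 2 * pi]) (f t * cos (n%:~R * t)).

Definition fourier_sin f n : R := (2 * pi)^-1 *
  \int[lebesgue_measure]_(t in `[0, 2 * pi]) (f t * sin (n%:~R * t)).

Lemma fourier_coef_sqrE f n :
  fourier_coef_sqr f n = fourier_cos f n ^+ 2 + fourier_sin f n ^+ 2.
Proof. by []. Qed.

Lemma fourier_cosB f g n : bounded_measurable f -> bounded_measurable g ->
  fourier_cos (g \- f) n = fourier_cos g n - fourier_cos f n.
Proof.
move=> bf bg; have bc := bounded_measurable_cos (R := R) n%:~R.
rewrite /fourier_cos -mulrBr -RintB; try exact: bounded_measurableM.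
by congr (_ * _); apply: eq_Rintegral => t _; rewrite -mulrBl.
Qed.

Lemma fourier_sinB f g n : bounded_measurable f -> bounded_measurable g ->
  fourier_sin (g \- f) n = fourier_sin g n - fourier_sin f n.
Proof.
move=> bf bg; have bc := bounded_measurable_sin (R := R) n%:~R.
rewrite /fourier_sin -mulrBr -RintB; try exact: bounded_measurableM.
by congr (_ * _); apply: eq_Rintegral => t _; rewrite -mulrBl.
Qed.

(** The expansion |g|^2 = |f|^2 + |g - f|^2 + 2 (f, g - f) in H^2, with the inner
    product split between the smoothness of f, measured in H^k, and weaker
    norms of g - f. The parameter beta is the scale at which low and high
    frequencies are separated; eta weighs the two factors. Everything is
    obtained for one frequency and then summed, so no inner product of two
    series appears. *)
Lemma sobolev_compare (k beta eta : R) f g : 2 <= k <= 4 -> 0 < beta -> 0 < eta ->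
  bounded_measurable f -> bounded_measurable g ->
  (H2 (g \- f)%R + H2 f <=
   H2 g +
   ((eta / beta)%:E * H0 (g \- f)%R +
    eta%:E * H2 (g \- f)%R +
    (eta^-1 * beta `^ (k / 2 - 1))%:E * Hs k f))%E.
Proof.
move=> k24 b0 e0 bf bg.
have w0 n : 0 <= freq n :> R by rewrite ltW// freq_gt0.
have c0 := @fourier_coef_sqr_ge0 R.
have t0 h n : 0 <= freq n ^+ 2 * fourier_coef_sqr h n :> R.
  by rewrite mulr_ge0// exprn_ge0.
have ke0 : 0 <= eta^-1 * beta `^ (k / 2 - 1).
  by rewrite mulr_ge0 ?powR_ge0// invr_ge0 ltW.
have e0' := ltW e0; have eb0 : 0 <= eta / beta by rewrite divr_ge0// ltW.
have s0 h n := sobolev_term_ge0 k h n.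
have q0 n := mulr_ge0 eb0 (c0 (g \- f) n).
have q1 n := mulr_ge0 e0' (t0 (g \- f) n).
have q2 n := mulr_ge0 ke0 (s0 f n).
have q01 n := addr_ge0 (q0 n) (q1 n).
have q012 n := addr_ge0 (q01 n) (q2 n).
rewrite -!wsumZ// -!wsumD//.
apply: le_wsum => n; rewrite !fourier_coef_sqrE fourier_cosB// fourier_sinB//.
set w := freq n.
have wp : 0 < w by exact: freq_gt0.
have P0 : 0 < beta^-1 + w ^+ 2 by rewrite addr_gt0 ?invr_gt0 ?exprn_gt0.
have PQ := weight_split _ _ _ k24 b0 wp.
have {}PQ : (w ^+ 2) ^+ 2 <= (beta^-1 + w ^+ 2) * (beta `^ (k / 2 - 1) * w `^ k).
  by rewrite -exprM.
have i1 := inner_product_split (fourier_cos f n) (fourier_cos g n) _ _ _ _ e0 P0 PQ.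
have i2 := inner_product_split (fourier_sin f n) (fourier_sin g n) _ _ _ _ e0 P0 PQ.
apply: le_trans (_ : _ <= _) _; last apply: (le_trans (lerD i1 i2)).
  by rewrite le_eqVlt; apply/orP; left; apply/eqP; ring.
by rewrite le_eqVlt; apply/orP; left; apply/eqP; ring.
Qed.

(** For every frequency, x ^ r <= 1 + x ^ 2 with x = b * freq n. *)
Lemma sobolev_interpolation (r b : R) f : 0 <= r <= 2 -> 0 < b ->
  ((b `^ r)%:E * Hs r f <=
   H0 f + (b ^+ 2)%:E * H2 f)%E.
Proof.
move=> /andP[r0 r2] b0.
have c0 := @fourier_coef_sqr_ge0 R.
have w0 n : 0 <= freq n :> R by rewrite ltW// freq_gt0.
have t0 n : 0 <= freq n ^+ 2 * fourier_coef_sqr f n :> R.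
  by rewrite mulr_ge0// exprn_ge0.
rewrite -!wsumZ ?powR_ge0 ?sqr_ge0// => [|n]; last exact: sobolev_term_ge0.
rewrite -wsumD// => [|n]; last by rewrite mulr_ge0// sqr_ge0.
apply: le_wsum => n; rewrite [leLHS]mulrA [X in _ + X]mulrA -[X in _ <= X + _]mul1r -mulrDl ler_wpM2r//.
rewrite -powRM ?(ltW b0)// -exprMn.
set x := b * freq n; have x0 : 0 <= x by rewrite mulr_ge0// ltW.
have [x1|x1] := leP 1 x.
  apply: (@le_trans _ _ (x `^ 2)); first exact: ler_powR.
  by rewrite powR_mulrn// lerDr.
apply: (@le_trans _ _ 1); last by rewrite lerDl sqr_ge0.
have : x `^ r <= 1 `^ r by apply: ge0_ler_powR; rewrite ?nnegrE ?(ltW x1).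
by rewrite powR1.
Qed.

Lemma sobolev2B_lty f g : bounded_measurable f -> bounded_measurable g ->
  (H2 f < +oo)%E -> (H2 g < +oo)%E -> (H2 (g \- f)%R < +oo)%E.
Proof.
move=> bf bg fo go.
have c0 := @fourier_coef_sqr_ge0 R.
have t0 h n : 0 <= freq n ^+ 2 * fourier_coef_sqr h n :> R.
  by rewrite mulr_ge0// exprn_ge0// ltW// freq_gt0.
apply: (@le_lt_trans _ _ (2%:E * H2 g + 2%:E * H2 f)%E).
  rewrite -!wsumZ// -wsumD//; last 2 first.
  - by move=> n; rewrite mulr_ge0.
  - by move=> n; rewrite mulr_ge0.
  apply: le_wsum => n; rewrite !fourier_coef_sqrE fourier_cosB// fourier_sinB//.
  rewrite !(mulrCA 2) -mulrDr ler_wpM2l ?exprn_ge0 ?(ltW (freq_gt0 _))//.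
  have := sqr_ge0 (fourier_cos g n + fourier_cos f n).
  have := sqr_ge0 (fourier_sin g n + fourier_sin f n).
  by nra.
by rewrite lte_add_pinfty// lte_mul_pinfty// lee_fin.
Qed.

End SobolevComparison.

(** * Estimates for an approximate minimizer *)

Section Rates.
Context {R : realType}.
Variables (r0 r1 : R) (r0_gt0 : 0 < r0) (r1_lt1 : r1 < 1).
Implicit Types (rad tru : R -> R) (m : R * R -> R) (alpha delta k : R).

Local Notation H0 f := (wsum (fourier_coef_sqr f)).
Local Notation H2 f := (wsum (fun n => freq n ^+ 2 * fourier_coef_sqr f n)%R).
Local Notation Hs s f := (wsum (fun n => freq n `^ s * fourier_coef_sqr f n)%R).

Lemma forward_dom_bounded rad : forward_dom r0 r1 rad -> bounded_measurable rad.
Proof.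
move=> dr; split; first exact: forward_dom_measurable dr.
exists r1 => x /=; rewrite in_itv/= => x0; have [_ /(_ _ x0) /andP[a b]] := dr.
by rewrite ger0_norm// (le_trans (ltW r0_gt0)).
Qed.

Lemma tikhonovE alpha m rad : tikhonov alpha m rad =
  (L2D_norm (forward rad \- m)%R ^+ 2 + alpha%:E * H2 rad)%E.
Proof. by rewrite /tikhonov sobolev_norm_sqr2. Qed.

Lemma fine_sobolev_norm k (f : R -> R) : (sobolev_norm k f < +oo)%E ->
  Hs k f = (fine (sobolev_norm k f) ^+ 2)%:E.
Proof.
move=> h; rewrite -sobolev_norm_sqr EFin_expe fineK//.
by rewrite ge0_fin_numE// sobolev_norm_ge0.
Qed.

Lemma fine_sobolev_norm2 (f : R -> R) : (sobolev_norm 2 f < +oo)%E ->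
  H2 f = (fine (sobolev_norm 2 f) ^+ 2)%:E.
Proof.
move=> h; rewrite -sobolev_norm_sqr2 EFin_expe fineK//.
by rewrite ge0_fin_numE// sobolev_norm_ge0.
Qed.

(** The true radius is a competitor in the minimization. *)
Lemma approx_minimizer_le alpha delta m rad tru : 0 < alpha -> 0 < delta ->
  forward_dom r0 r1 tru -> (L2D_norm (forward tru \- m)%R <= delta%:E)%E ->
  approx_minimizer r0 r1 alpha delta m rad ->
  (L2D_norm (forward rad \- m)%R ^+ 2 + alpha%:E * H2 rad <=
   (2 * delta ^+ 2)%:E + alpha%:E * H2 tru)%E.
Proof.
move=> a0 d0 dt mt [dr]; rewrite -tikhonovE => /le_trans; apply.
have h : (ereal_inf [set tikhonov alpha m x | x in forward_dom r0 r1] <=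
    tikhonov alpha m tru)%E by apply: ereal_inf_lbound; exists tru.
apply: (le_trans (leeD2r _ h)); rewrite tikhonovE.
rewrite addeAC leeD2r// mulr_natl mulr2n EFinD leeD2r//.
by apply/L2D_norm_le => //; exact: ltW.
Qed.

(** Everything that the convergence rates use, as inequalities between real
    numbers: x2 is the squared residual, e2 the squared data error, n0 and n2
    the squared H^0 and H^2 norms of the error of the radius. The last part
    combines minimality with the comparison of H^2 norms, in which the norm of
    the minimizer itself cancels; beta is left free because the a priori choice
    and the discrepancy principle need different values of it. *)
Lemma residual_estimates alpha delta m k rad tru :
  0 < alpha -> 0 < delta -> 2 <= k <= 4 -> Hper k tru ->
  forward_dom r0 r1 tru -> L2_on plane_measure square m ->
  (L2D_norm (forward tru \- m)%R <= delta%:E)%E ->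
  approx_minimizer r0 r1 alpha delta m rad ->
  exists x2 e2 n0 n2 : R,
  [/\ [/\ 0 <= x2, 0 <= n0 & 0 <= n2],
      [/\ (L2D_norm (forward rad \- m)%R ^+ 2 = x2%:E)%E,
        (L2D_norm (forward rad \- forward tru)%R ^+ 2 = e2%:E)%E,
        H0 (rad \- tru)%R = n0%:E & H2 (rad \- tru)%R = n2%:E],
      x2 <= 2 * delta ^+ 2 + alpha * fine (sobolev_norm 2 tru) ^+ 2,
      e2 <= 2 * x2 + 2 * delta ^+ 2 /\ r0 * n0 <= e2
    & forall beta eta, 0 < beta -> 0 < eta ->
      x2 + alpha * n2 <= 2 * delta ^+ 2 + alpha * (eta / beta * n0 + eta * n2 +
        eta^-1 * beta `^ (k / 2 - 1) * fine (sobolev_norm k tru) ^+ 2)].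
Proof.
move=> a0 d0 k24 [_ tk] dt mm mt am.
have dr : forward_dom r0 r1 rad by case: am.
have [[_ fr] _] := dr; have [[_ ft] _] := dt.
have br := forward_dom_bounded _ dr; have bt := forward_dom_bounded _ dt.
have := approx_minimizer_le _ _ _ _ _ a0 d0 dt mt am.
have t0 h n : 0 <= freq n ^+ 2 * fourier_coef_sqr h n :> R.
  by rewrite mulr_ge0 ?fourier_coef_sqr_ge0// exprn_ge0// ltW// freq_gt0.
have [s2 s20 Es2] : exists2 s2, 0 <= s2 & H2 rad = s2%:E.
  by exists (fine (sobolev_norm 2 rad) ^+ 2); [exact: sqr_ge0|exact: fine_sobolev_norm2].
have fin_ge0 (z : \bar R) : (0 <= z < +oo)%E -> exists2 y, 0 <= y & z = y%:E.
  case: z => [z| |] => /andP[]//.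
  by rewrite lee_fin => z0 _; exists z.
have [n2 n20 En2] : exists2 n2, 0 <= n2 & H2 (rad \- tru) = n2%:E.
  apply: fin_ge0; rewrite wsum_ge0//= sobolev2B_lty//.
    by rewrite fine_sobolev_norm2// ltry.
  by rewrite Es2 ltry.
rewrite Es2 fine_sobolev_norm2//.
set t2 := fine _ ^+ 2; have t20 : 0 <= t2 by exact: sqr_ge0.
move=> tik.
have [x2 x20 Ex2] : exists2 x2, 0 <= x2 & (L2D_norm (forward rad \- m)%R ^+ 2 = x2%:E)%E.
  apply: fin_ge0; rewrite sqre_ge0/=.
  apply: le_lt_trans (ltry (2 * delta ^+ 2 + alpha * t2)).
  apply: le_trans tik; rewrite leeDl// -EFinM lee_fin.
  by rewrite mulr_ge0// ltW.
have etri := forward_triangle _ _ r0_gt0 r1_lt1 _ _ _ dr dt mm.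
have mt2 : (L2D_norm (forward tru \- m)%R ^+ 2 <= (delta ^+ 2)%:E)%E.
  by apply/L2D_norm_le => //; exact: ltW.
have etri' : (L2D_norm (forward rad \- forward tru)%R ^+ 2 <= (2 * x2 + 2 * delta ^+ 2)%:E)%E.
  apply: (le_trans etri); rewrite Ex2 (EFinD (2 * x2)) !(EFinM 2) leeD2l//.
  by rewrite lee_wpmul2l.
have [e2 e20 Ee2] : exists2 e2, 0 <= e2 & (L2D_norm (forward rad \- forward tru)%R ^+ 2 = e2%:E)%E.
  by apply: fin_ge0; rewrite sqre_ge0/= (le_lt_trans etri')// ltry.
have be : bounded_measurable (rad \- tru) by exact: bounded_measurableB.
have stab : (r0%:E * H0 (rad \- tru)%R <= e2%:E)%E.
  rewrite -Ee2; apply: le_trans (forward_conditional_stability _ _ r0_gt0 r1_lt1 _ _ dr dt).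
  by rewrite -sobolev_norm_sqr0 lee_wpmul2l ?lee_fin ?(ltW r0_gt0)// sobolev_norm0_le.
have [n0 n00 En0] : exists2 n0, 0 <= n0 & H0 (rad \- tru) = n0%:E.
  apply: fin_ge0; rewrite wsum_ge0/= ?ltNge; last by move=> n; exact: fourier_coef_sqr_ge0.
  apply/negP => h; move: stab; rewrite leye_eq in h.
  by rewrite (eqP h) gt0_muley ?lte_fin.
exists x2, e2, n0, n2; split => //.
- move: tik; rewrite Ex2 -!EFinM -!EFinD lee_fin; apply: le_trans.
  by rewrite lerDl mulr_ge0// ltW.
- by split; [move: etri'; rewrite Ee2 lee_fin|move: stab; rewrite En0 -EFinM lee_fin].
move=> beta eta b0 e0.
have := sobolev_compare k beta eta tru rad k24 b0 e0 bt br.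
rewrite En0 En2 Es2 fine_sobolev_norm2// -/t2 fine_sobolev_norm//.
rewrite -!EFinM -!EFinD lee_fin => cmp.
move: tik; rewrite Ex2 -!EFinM -!EFinD lee_fin => tik.
move: cmp; rewrite -(ler_pM2l a0) !mulrDr => cmp.
by rewrite -(lerD2r (alpha * t2)); lra.
Qed.

End Rates.

(** * The a priori choice of the parameter *)

Section Conclusion.
Context {R : realType}.
Variables (r0 r1 : R) (r0_gt0 : 0 < r0) (r0_lt1 : r0 < 1) (r1_lt1 : r1 < 1).
Implicit Types (rad tru : R -> R) (m : R * R -> R) (alpha delta k : R).

Local Notation H0 f := (wsum (fourier_coef_sqr f)).
Local Notation H2 f := (wsum (fun n => freq n ^+ 2 * fourier_coef_sqr f n)%R).

Lemma powR_scale_sqr delta k : 0 < delta -> 0 < k ->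
  (delta `^ (4 / k)) `^ (k / 2) = delta ^+ 2.
Proof.
move=> d0 k0; rewrite -powRrM -powR_mulrn ?ltW//; congr (_ `^ _).
by field; exact: lt0r_neq0.
Qed.

(** With b = delta ^ (2 / k), interpolation bounds b ^ r times the squared H^r
    norm by K * delta ^ 2, and delta ^ 2 / b ^ r = (delta ^ (1 - r / k)) ^ 2.
    The factor 1 + K stands for any number whose square exceeds K. *)
Lemma error_estimates_of_bounds (K k delta e2 n0 n2 : R) rad tru :
  0 <= K -> 2 <= k -> 0 < delta ->
  (L2D_norm (forward rad \- forward tru)%R ^+ 2 = e2%:E)%E ->
  H0 (rad \- tru)%R = n0%:E -> H2 (rad \- tru)%R = n2%:E ->
  e2 <= K * delta ^+ 2 -> n0 + delta `^ (4 / k) * n2 <= K * delta ^+ 2 ->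
  error_estimates (1 + K) k delta tru rad.
Proof.
move=> K0 k2 d0 Ee2 En0 En2 he hn.
have k0 : 0 < k by lra.
have K1 : K <= (1 + K) ^+ 2 by nra.
have CK0 : 0 <= 1 + K by lra.
split.
  apply/L2D_norm_le; first by rewrite mulr_ge0// ltW.
  by rewrite Ee2 lee_fin exprMn (le_trans he)// ler_wpM2r ?sqr_ge0.
move=> r r02.
have c0 : 0 <= (1 + K) * delta `^ (1 - r / k) by rewrite mulr_ge0// powR_ge0.
rewrite -lee_sqr ?sobolev_norm_ge0 ?lee_fin//.
rewrite sobolev_norm_sqr -EFin_expe.
have dd (s t : R) : delta `^ (s + t) = delta `^ s * delta `^ t.
  by rewrite powRD// (gt_eqF d0) implybT.
pose b := delta `^ (2 / k).
have b0 : 0 < b by rewrite powR_gt0.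
have b2 : b ^+ 2 = delta `^ (4 / k).
  rewrite /b -powR_mulrn ?powR_ge0// -powRrM; congr (_ `^ _).
  by field; exact: lt0r_neq0.
have := sobolev_interpolation r b (rad \- tru) r02 b0.
rewrite En0 En2 b2 -!EFinM -EFinD => h.
rewrite -(@lee_pmul2l _ (b `^ r)%:E) ?lte_fin ?powR_gt0//.
apply: (le_trans h); rewrite -EFinM lee_fin.
apply: (le_trans hn); rewrite exprMn [leRHS]mulrCA.
have -> : b `^ r * (delta `^ (1 - r / k)) ^+ 2 = delta ^+ 2.
  rewrite /b -powRrM expr2 -!dd -powR_mulrn ?ltW//; congr (_ `^ _).
  by field; exact: lt0r_neq0.
by rewrite ler_wpM2r ?sqr_ge0.
Qed.

(** Twice 1 / eta for eta = r0 / 4, the factor 2 coming from the absorption, times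
    the square of a bound M for the H^k norm. *)
Definition rate_constant (M : R) : R := 8 / r0 * M ^+ 2.

Lemma rate_constant_ge0 M : 0 <= rate_constant M.
Proof. by rewrite mulr_ge0 ?sqr_ge0// divr_ge0// ltW. Qed.

(** Here beta is the regularization parameter itself and eta = r0 / 4, which is
    small enough for the error terms on the right side to be absorbed. It
    matters for the discrepancy principle that the factor 5 of delta ^ 2 is
    smaller than 4 ^ 2. *)
Lemma residual_le alpha delta k M x2 e2 n0 n2 : 0 < alpha ->
  0 <= x2 -> 0 <= n0 -> 0 <= n2 -> e2 <= 2 * x2 + 2 * delta ^+ 2 -> r0 * n0 <= e2 ->
  (forall beta eta, 0 < beta -> 0 < eta ->
    x2 + alpha * n2 <= 2 * delta ^+ 2 + alpha * (eta / beta * n0 + eta * n2 +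
        eta^-1 * beta `^ (k / 2 - 1) * M ^+ 2)) ->
  x2 + alpha * n2 <= 5 * delta ^+ 2 + rate_constant M * alpha `^ (k / 2).
Proof.
move=> a0 x0 n00 n20 he hn.
(* eta * n0 <= e2 / 4 <= x2 / 2 + delta ^+ 2 / 2 and eta <= 1 / 4 *)
move=> /(_ alpha (r0 / 4) a0).
have q0 : 0 < r0 / 4 by rewrite divr_gt0.
move=> /(_ q0).
have aE : alpha `^ (k / 2) = alpha * alpha `^ (k / 2 - 1).
  rewrite -{2}(powRr1 (ltW a0)) -powRD ?(gt_eqF a0) ?implybT//.
  by congr (_ `^ _); ring.
rewrite aE; set p := alpha `^ _ => h.
have -> : rate_constant M * (alpha * p) = 2 * (alpha * ((r0 / 4)^-1 * p * M ^+ 2)).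
  by rewrite /rate_constant; field; exact: lt0r_neq0.
move: h; rewrite !mulrDr.
have -> : alpha * (r0 / 4 / alpha * n0) = r0 * n0 / 4.
  by field; exact: lt0r_neq0.
have an0 : 0 <= alpha * n2 by rewrite mulr_ge0// ltW.
have h4 : alpha * (r0 / 4 * n2) <= alpha * n2 / 4.
  have -> : alpha * (r0 / 4 * n2) = r0 * (alpha * n2 / 4) by ring.
  have q4 : 0 <= alpha * n2 / 4 by lra.
  by rewrite ler_piMl// ltW.
set z := alpha * (_ * p * _); lra.
Qed.

Lemma apriori_rate (M k delta : R) m rad tru :
  2 <= k <= 4 -> Hper k tru -> forward_dom r0 r1 tru -> 0 < delta ->
  L2_on plane_measure square m ->
  (L2D_norm (forward tru \- m)%R <= delta%:E)%E ->
  M = fine (sobolev_norm k tru) ->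
  approx_minimizer r0 r1 (delta `^ (4 / k)) delta m rad ->
  error_estimates (1 + 2 / r0 * (6 + rate_constant M)) k delta tru rad.
Proof.
move=> k24 hk dt d0 mm mt ME am.
have [k2 k4] := andP k24; have k0 : 0 < k by lra.
have a0 : 0 < delta `^ (4 / k) by rewrite powR_gt0.
have [x2 [e2 [n0 [n2]]]] :=
  residual_estimates _ _ r0_gt0 r1_lt1 _ _ _ _ _ _ a0 d0 k24 hk dt mm mt am.
move=> [[x20 n00 n20] [Ex2 Ee2 En0 En2] _ [he hn]]; rewrite -ME => hyp.
have := residual_le _ _ _ _ _ _ _ _ a0 x20 n00 n20 he hn hyp.
rewrite powR_scale_sqr// => res.
have c0 := rate_constant_ge0 M.
have an0 : 0 <= delta `^ (4 / k) * n2 by rewrite mulr_ge0// ltW.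
have d20 : 0 <= delta ^+ 2 by exact: sqr_ge0.
set c := rate_constant M in c0 res *.
have cd : 0 <= c * delta ^+ 2 by rewrite mulr_ge0.
have r01 : 1 <= r0^-1 by rewrite invf_ge1// ltW.
have i0 : 0 <= r0^-1 by lra.
set X := x2 + delta `^ (4 / k) * n2 in res.
have X0 : 0 <= X by rewrite addr_ge0.
have XB : 2 * X + 2 * delta ^+ 2 <= 2 * (6 + c) * delta ^+ 2 by lra.
have e2B : e2 <= 2 * (6 + c) * delta ^+ 2 by rewrite /X in XB; lra.
have tot : 2 / r0 * (6 + c) * delta ^+ 2 = r0^-1 * (2 * (6 + c) * delta ^+ 2) by ring.
apply: (error_estimates_of_bounds _ _ _ _ _ _ _ _ _ k2 d0 Ee2 En0 En2).
- by rewrite mulr_ge0 ?divr_ge0 ?addr_ge0// ltW.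
- rewrite tot (le_trans e2B)// ler_peMl// mulr_ge0// mulr_ge0// addr_ge0//.
rewrite tot; apply: (@le_trans _ _ (r0^-1 * (2 * X + 2 * delta ^+ 2))); last by rewrite ler_wpM2l.
have n0B : n0 <= r0^-1 * (2 * x2 + 2 * delta ^+ 2).
  by rewrite ler_pdivlMl// (le_trans hn).
apply: (@le_trans _ _ (r0^-1 * (2 * x2 + 2 * delta ^+ 2) + r0^-1 * (2 * (delta `^ (4 / k) * n2)))).
  apply: lerD => //; apply: (@le_trans _ _ (2 * (delta `^ (4 / k) * n2))); first by lra.
  by rewrite ler_peMl// mulr_ge0.
by rewrite -mulrDr ler_wpM2l// /X; lra.
Qed.

End Conclusion.

(** * The discrepancy principle *)

Section Discrepancy.
Context {R : realType}.
Variables (r0 r1 : R) (r0_gt0 : 0 < r0) (r0_lt1 : r0 < 1) (r1_lt1 : r1 < 1).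
Implicit Types (tru : R -> R) (m : R * R -> R) (alpha delta k : R).

Local Notation cM := (rate_constant r0).

Lemma dyadic_small (alpha0 t : R) : 0 < alpha0 -> 0 < t ->
  exists n : nat, alpha0 * 2 ^- n <= t.
Proof.
move=> a0 t0; have q0 : 0 <= alpha0 / t by rewrite divr_ge0// ltW.
exists (Num.bound (alpha0 / t)).
rewrite ler_pdivrMr ?exprn_gt0// mulrC -ler_pdivrMr//.
apply: (le_trans (ltW (archi_boundP q0))).
by rewrite -natrX ler_nat ltnW// ltn_expl.
Qed.

(** The residual is at most 4 * delta as soon as alpha is so small that alpha
    times the squared H^2 norm of the true radius is below delta ^ 2; the
    maximum is then attained at the least index that passes the test. *)
Lemma discrepancy_nonempty alpha0 delta k m tru (sel : R -> R -> R) :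
  0 < alpha0 -> 0 < delta -> 2 <= k <= 4 -> Hper k tru ->
  forward_dom r0 r1 tru -> L2_on plane_measure square m ->
  (L2D_norm (forward tru \- m)%R <= delta%:E)%E ->
  (forall n : nat, approx_minimizer r0 r1 (alpha0 * 2 ^- n) delta m
     (sel (alpha0 * 2 ^- n))) ->
  exists alpha, is_max (discrepancy_set alpha0 delta m sel) alpha.
Proof.
move=> a0 d0 k24 hk dt mm mt am.
have an0 n : 0 < alpha0 * 2 ^- n by rewrite divr_gt0// exprn_gt0.
pose P n := `[< (L2D_norm (forward (sel (alpha0 * 2 ^- n)) \- m)%R <= (4 * delta)%:E)%E >].
have exP : exists n, P n.
  set t2 := fine (sobolev_norm 2 tru) ^+ 2.
  have t20 : 0 <= t2 by exact: sqr_ge0.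
  have d2 : 0 < delta ^+ 2 by rewrite exprn_gt0.
  have [n nt] := dyadic_small alpha0 (delta ^+ 2 / (1 + t2)) a0
    (divr_gt0 d2 (ltr_wpDr t20 ltr01)).
  exists n; apply/asboolP/L2D_norm_le; first by rewrite mulr_ge0// ltW.
  have [x2 [e2 [n0 [n2 [_ [-> _ _ _] xle _ _]]]]] :=
    residual_estimates _ _ r0_gt0 r1_lt1 _ _ _ _ _ _ (an0 n) d0 k24 hk dt mm mt (am n).
  rewrite lee_fin (le_trans xle)// -/t2.
  have tt : alpha0 * 2 ^- n * t2 <= delta ^+ 2.
    rewrite -[leRHS](divfK (lt0r_neq0 (ltr_wpDr t20 ltr01)) (delta ^+ 2)).
    by apply: ler_pM => //; [exact: ltW|rewrite lerDr].
  rewrite exprMn; lra.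
have [n /asboolP Pn nmin] := ex_minnP exP.
exists (alpha0 * 2 ^- n); split; first by exists n.
move=> _ [j [-> /asboolP Pj]].
by rewrite ler_wpM2l ?(ltW a0)// lef_pV2 ?posrE ?exprn_gt0// ler_weXn2l ?ler1n ?nmin.
Qed.

(** The selected parameter cannot be much smaller than delta ^ (4 / k): either it
    is the largest candidate alpha0, or its double a' failed the test. In the
    second case the squared residual at a' exceeds 16 * delta ^ 2 but is at most
    5 * delta ^ 2 plus a multiple of a' ^ (k / 2), so the latter dominates
    delta ^ 2. *)
Lemma discrepancy_lower_bound alpha0 delta_max delta k M m tru (sel : R -> R -> R) alpha :
  0 < alpha0 -> 0 < delta <= delta_max -> 2 <= k <= 4 -> Hper k tru ->
  forward_dom r0 r1 tru -> L2_on plane_measure square m ->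
  (L2D_norm (forward tru \- m)%R <= delta%:E)%E ->
  M = fine (sobolev_norm k tru) ->
  (forall n : nat, approx_minimizer r0 r1 (alpha0 * 2 ^- n) delta m
     (sel (alpha0 * 2 ^- n))) ->
  is_max (discrepancy_set alpha0 delta m sel) alpha ->
  delta `^ (4 / k) <= ((1 + delta_max) ^+ 2 / alpha0 + 2 * (1 + cM M)) * alpha.
Proof.
move=> a0 /andP[d0 dm] k24 hk dt mm mt ME am [[n [-> _]] amax].
have [k2 k4] := andP k24; have k0 : 0 < k by lra.
have an0 j : 0 < alpha0 * 2 ^- j by rewrite divr_gt0// exprn_gt0.
have c0 := rate_constant_ge0 r0 r0_gt0 M.
have A0 : 0 <= (1 + delta_max) ^+ 2 / alpha0 by rewrite divr_ge0 ?sqr_ge0// ltW.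
case: n amax => [|n] amax.
  rewrite expr0 invr1 mulr1.
  have q1 : 1 <= 1 + delta_max by lra.
  apply: (@le_trans _ _ ((1 + delta_max) ^+ 2)); last first.
    by rewrite mulrDl divfK ?lt0r_neq0// lerDl !mulr_ge0 ?addr_ge0 ?(ltW a0).
  apply: (@le_trans _ _ ((1 + delta_max) `^ (4 / k))).
    by apply: ge0_ler_powR; rewrite ?nnegrE ?divr_ge0//; lra.
  rewrite -powR_mulrn; last by lra.
  by apply: ler_powR => //; rewrite ler_pdivrMr//; lra.
set a' := alpha0 * 2 ^- n.
have a'E : a' = 2 * (alpha0 * 2 ^- n.+1).
  by rewrite /a' exprS; field; rewrite expf_neq0.
have a'0 : 0 < a' by exact: an0.
have big : ~ (L2D_norm (forward (sel a') \- m)%R <= (4 * delta)%:E)%E.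
  move=> h; have /amax : discrepancy_set alpha0 delta m sel a' by exists n.
  by rewrite a'E ger_pMl ?an0// lern1.
have [x2 [e2 [n0 [n2]]]] :=
  residual_estimates _ _ r0_gt0 r1_lt1 _ _ _ _ _ _ a'0 d0 k24 hk dt mm mt (am n).
move=> [[x20 n00 n20] [Ex2 _ _ _] _ [he hn]]; rewrite -ME => hyp.
have res := residual_le _ r0_gt0 r0_lt1 _ _ _ _ _ _ _ _ a'0 x20 n00 n20 he hn hyp.
have x2big : 16 * delta ^+ 2 < x2.
  rewrite ltNge; apply/negP => h; apply: big.
  apply/L2D_norm_le; first by rewrite mulr_ge0// ltW.
  by rewrite Ex2 lee_fin exprMn; lra.
have an2 : 0 <= a' * n2 by rewrite mulr_ge0// ltW.
have p0 : 0 <= a' `^ (k / 2) by exact: powR_ge0.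
have cp0 : 0 <= cM M * a' `^ (k / 2) by rewrite mulr_ge0.
have d20 : 0 <= delta ^+ 2 by exact: sqr_ge0.
have dle : delta ^+ 2 <= (1 + cM M) * a' `^ (k / 2).
  by rewrite mulrDl mul1r; lra.
have q1 : 1 <= 1 + cM M by lra.
have q0 : 0 <= 1 + cM M by lra.
have E1 : delta `^ (4 / k) = (delta ^+ 2) `^ (2 / k).
  rewrite -powR_mulrn ?ltW// -powRrM; congr (_ `^ _).
  by field; exact: lt0r_neq0.
have E2 : (a' `^ (k / 2)) `^ (2 / k) = a'.
  rewrite -powRrM -[RHS](powRr1 (ltW a'0)); congr (_ `^ _).
  by field; exact: lt0r_neq0.
have : delta `^ (4 / k) <= (1 + cM M) * a'.
  rewrite E1; apply: (@le_trans _ _ (((1 + cM M) * a' `^ (k / 2)) `^ (2 / k))).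
    by apply: ge0_ler_powR; rewrite ?nnegrE ?divr_ge0 ?mulr_ge0//; lra.
  rewrite powRM// E2 ler_wpM2r ?(ltW a'0)//.
  rewrite -[leRHS](powRr1 q0); apply: ler_powR => //.
  by rewrite ler_pdivrMr// mul1r.
move=> /le_trans; apply; rewrite mulrDl a'E.
have := mulr_ge0 A0 (ltW (an0 n.+1)); lra.
Qed.

(** The test itself bounds the residual, hence the data error and the H^0 error.
    For the H^2 error the comparison is used with beta = delta ^ (4 / k), not
    with alpha, which may be much larger; the lower bound on alpha controls the
    remaining term delta ^ 2 / alpha. *)
Lemma discrepancy_rate alpha0 delta_max delta k M m tru (sel : R -> R -> R) alpha :
  0 < alpha0 -> 0 < delta <= delta_max -> 2 <= k <= 4 -> Hper k tru ->
  forward_dom r0 r1 tru -> L2_on plane_measure square m ->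
  (L2D_norm (forward tru \- m)%R <= delta%:E)%E ->
  M = fine (sobolev_norm k tru) ->
  (forall n : nat, approx_minimizer r0 r1 (alpha0 * 2 ^- n) delta m
     (sel (alpha0 * 2 ^- n))) ->
  is_max (discrepancy_set alpha0 delta m sel) alpha ->
  error_estimates (1 + (68 / r0 + 34 + 4 * M ^+ 2 +
     4 * ((1 + delta_max) ^+ 2 / alpha0 + 2 * (1 + cM M)))) k delta tru (sel alpha).
Proof.
move=> a0 dd k24 hk dt mm mt ME am amax.
have lb := discrepancy_lower_bound _ _ _ _ _ _ _ _ _ a0 dd k24 hk dt mm mt ME am amax.
have [d0 dm] := andP dd; have [k2 k4] := andP k24; have k0 : 0 < k by lra.
have c0 := rate_constant_ge0 r0 r0_gt0 M.
move: lb; set L := _ + 2 * (1 + cM M) => lb.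
have L0 : 0 <= L.
  by rewrite addr_ge0 ?divr_ge0 ?sqr_ge0 ?(ltW a0)// mulr_ge0// addr_ge0.
case: amax => [[n [alphaE test]] _].
have al0 : 0 < alpha by rewrite alphaE divr_gt0// exprn_gt0.
have amn : approx_minimizer r0 r1 alpha delta m (sel alpha) by rewrite alphaE.
have [x2 [e2 [n0 [n2]]]] :=
  residual_estimates _ _ r0_gt0 r1_lt1 _ _ _ _ _ _ al0 d0 k24 hk dt mm mt amn.
move=> [[x20 n00 n20] [Ex2 Ee2 En0 En2] _ [he hn]]; rewrite -ME.
set b := delta `^ (4 / k) in lb *.
have b0 : 0 < b by rewrite powR_gt0.
have h20 : 0 < 2^-1 :> R by rewrite invr_gt0.
(* eta = 1 / 2 lets half of alpha * n2 be absorbed *)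
move=> /(_ b 2^-1 b0 h20) hyp.
have d20 : 0 <= delta ^+ 2 by exact: sqr_ge0.
have x2B : x2 <= 16 * delta ^+ 2.
  have : (L2D_norm (forward (sel alpha) \- m)%R ^+ 2 <= ((4 * delta) ^+ 2)%:E)%E.
    by apply/L2D_norm_le => //; rewrite mulr_ge0// ltW.
  by rewrite Ex2 lee_fin exprMn; lra.
have e2B : e2 <= 34 * delta ^+ 2 by lra.
have n0B : n0 <= 34 / r0 * delta ^+ 2.
  by rewrite mulrAC ler_pdivlMr// mulrC (le_trans hn).
have bp : b * b `^ (k / 2 - 1) = delta ^+ 2.
  rewrite -{1}(powRr1 (ltW b0)) -powRD ?(gt_eqF b0) ?implybT//.
  by rewrite -(powR_scale_sqr _ _ d0 k0); congr (_ `^ _); ring.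
have key : b * n2 <= 4 * delta ^+ 2 * L + n0 + 4 * delta ^+ 2 * M ^+ 2.
  rewrite -(ler_pM2l al0).
  have -> : alpha * (4 * delta ^+ 2 * L + n0 + 4 * delta ^+ 2 * M ^+ 2) =
      4 * delta ^+ 2 * (L * alpha) +
      2 * b * (alpha * (2^-1 / b * n0 + 2 * b `^ (k / 2 - 1) * M ^+ 2)).
    rewrite -bp; field; exact: lt0r_neq0.
  have h1 : 4 * delta ^+ 2 * b <= 4 * delta ^+ 2 * (L * alpha).
    by rewrite ler_wpM2l// mulr_ge0.
  apply: le_trans (lerD h1 (lexx _)).
  have h2 : 2 * b * (alpha * n2 / 2) <=
      2 * b * (2 * delta ^+ 2 + alpha * (2^-1 / b * n0 + 2 * b `^ (k / 2 - 1) * M ^+ 2)).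
    rewrite ler_wpM2l ?mulr_ge0 ?(ltW b0)//.
    by move: hyp; rewrite invrK !mulrDr; lra.
  have -> : alpha * (b * n2) = 2 * b * (alpha * n2 / 2) by field.
  by apply: (le_trans h2); rewrite mulrDr lerD2r; lra.
have M0 : 0 <= M ^+ 2 by exact: sqr_ge0.
have r00 : 0 <= 34 / r0 by rewrite divr_ge0// ltW.
have r68 : 68 / r0 = 2 * (34 / r0) by ring.
have t1 := mulr_ge0 r00 d20; have t2 := mulr_ge0 M0 d20; have t3 := mulr_ge0 L0 d20.
apply: (error_estimates_of_bounds _ _ _ _ _ _ _ _ _ k2 d0 Ee2 En0 En2).
- by rewrite r68; lra.
- by rewrite r68; move: t1 t2 t3 e2B; nra.
- by rewrite -/b r68; move: t1 t2 t3 key n0B; nra.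
Qed.

End Discrepancy.

Theorem theorem2p1 (R : realType) (r0 r1 : R)
    (hr0 : 0 < r0) (hr01 : r0 < r1) (hr1 : r1 < 1) :
  (exists C : R -> R,
     forall (k : R) (rad_true : R -> R) (m : R * R -> R) (delta : R)
            (rad : R -> R),
       2 <= k <= 4 ->
       Hper k rad_true -> forward_dom r0 r1 rad_true ->
       0 < delta ->
       L2_on plane_measure square m ->
       (L2D_norm (forward rad_true \- m)%R <= delta%:E)%E ->
       approx_minimizer r0 r1 (delta `^ (4 / k)) delta m rad ->
       error_estimates (C (fine (sobolev_norm k rad_true))) k delta
         rad_true rad)
  /\
  (forall (alpha0 delta_max : R), 0 < alpha0 -> 0 < delta_max ->
   exists C : R -> R,
     forall (k : R) (rad_true : R -> R) (m : R * R -> R) (delta : R)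
            (sel : R -> R -> R),
       2 <= k <= 4 ->
       Hper k rad_true -> forward_dom r0 r1 rad_true ->
       0 < delta <= delta_max ->
       L2_on plane_measure square m ->
       (L2D_norm (forward rad_true \- m)%R <= delta%:E)%E ->
       (forall n : nat,
          approx_minimizer r0 r1 (alpha0 * 2 ^- n) delta m
            (sel (alpha0 * 2 ^- n))) ->
       (exists alpha : R, is_max (discrepancy_set alpha0 delta m sel) alpha)
       /\
       (forall alpha : R, is_max (discrepancy_set alpha0 delta m sel) alpha ->
          error_estimates (C (fine (sobolev_norm k rad_true))) k delta
            rad_true (sel alpha))).
Proof.
have r01 : r0 < 1 by exact: lt_trans hr1.
split.
  exists (fun M => 1 + 2 / r0 * (6 + rate_constant r0 M)).
  move=> k tru m delta rad k24 hk dt d0 mm mt am.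
  exact: (apriori_rate r0 r1 hr0 r01 hr1 _ k delta m).
move=> alpha0 delta_max a0 dm0.
exists (fun M => 1 + (68 / r0 + 34 + 4 * M ^+ 2 +
  4 * ((1 + delta_max) ^+ 2 / alpha0 + 2 * (1 + rate_constant r0 M)))).
move=> k tru m delta sel k24 hk dt dd mm mt am; split.
  have [d0 _] := andP dd.
  exact: (discrepancy_nonempty r0 r1 hr0 hr1 alpha0 delta k m tru).
move=> alpha amax.
exact: (discrepancy_rate r0 r1 hr0 r01 hr1 alpha0 delta_max delta k _ m tru).
Qed.
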